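(* The weakly monotone $C^*$-algebra $\mathcal{W}_{\mathbb{N}}$ is type I.
   Context: Here $\mathbb{N}=\{1,2,\ldots\}$ and $\{e_i:i\in\mathbb{N}\}$ is the canonical orthonormal basis of $\ell^2(\mathbb{N})$. The weakly monotone Fock space $\mathcal{F}_{wm}(\ell^2(\mathbb{N}))$ is the closed subspace of the full Fock space with orthonormal basis the vacuum $\Omega$ and all $e_{i_1}\otimes\cdots\otimes e_{i_k}$, $k\geq 1$, $i_1\geq\cdots\geq i_k\geq 1$. For $i\in\mathbb{N}$ the creator $A_i^\dagger$ is given by $A_i^\dagger\Omega=e_i$ and $A_i^\dagger\, e_{i_1}\otimes\cdots\otimes e_{i_k}=e_i\otimes e_{i_1}\otimes\cdots\otimes e_{i_k}$ if $i\geq i_1$ and $0$ otherwise; $A_i$ is its adjoint. $\mathcal{W}_{\mathbb{N}}\subset\mathcal{B}(\mathcal{F}_{wm}(\ell^2(\mathbb{N})))$ is the $C^*$-algebra generated by $\{A_i,A_i^\dagger:i\in\mathbb{N}\}$. *)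

(* Defs.v *)
From HB Require Import structures.
From mathcomp Require Import all_boot all_order all_algebra finmap.
From mathcomp Require Import complex.
From mathcomp Require Import boolp classical_sets functions cardinality fsbigop.
From mathcomp Require Import reals ereal topology normedtype sequences esum.
From mathcomp Require Import ring lra.

Set Implicit Arguments.
Unset Strict Implicit.
Unset Printing Implicit Defensive.

Import Order.TTheory GRing.Theory Num.Theory.
Import numFieldNormedType.Exports.

Local Open Scope classical_set_scope.
Local Open Scope complex_scope.
Local Open Scope ring_scope.

HB.mixin Record CompleteNormedModule_isHilbert (R : realType) H
    & CompleteNormedModule R[i] H := {
  inner : H -> H -> R[i];
  inner_linearl : forall (a : R[i]) (x y z : H),
    inner (a *: x + y) z = a * inner x z + inner y z;
  inner_conj : forall x y : H, inner y x = (inner x y)^*;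
  inner_norm : forall x : H, inner x x = `|x| ^+ 2
}.

#[short(type="hilbertType")]
HB.structure Definition Hilbert (R : realType) :=
  {H of CompleteNormedModule R[i] H & CompleteNormedModule_isHilbert R H}.

Section Operators.
Context {R : realType} {H : hilbertType R}.
Implicit Types (S T e z : H -> H) (A G M : set (H -> H)).

Definition bounded_op T : Prop := linear T /\ continuous T.

(* [S] is the adjoint of [T]. *)
Definition adjoint_of T S : Prop :=
  forall x y, inner (T x) y = inner x (S y).

Definition projection e : Prop :=
  [/\ bounded_op e, e \o e = e & adjoint_of e e].

Record cstar_subalgebra A : Prop := {
  cstar_bounded : A `<=` bounded_op;
  cstar_zero : A (fun=> 0);
  cstar_linear : forall (a : R[i]) S T,
    A S -> A T -> A (fun x => a *: S x + T x);
  cstar_mul : forall S T, A S -> A T -> A (S \o T);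
  cstar_adjoint : forall S T, A S -> adjoint_of S T -> A T;
  cstar_closed : forall T, bounded_op T ->
    (forall eps : R, 0 < eps ->
       exists2 S, A S & forall x, `|T x - S x| <= eps%:C * `|x|) ->
    A T
}.

Definition cstar_generated G : set (H -> H) := smallest cstar_subalgebra G.

Definition commutant M : set (H -> H) :=
  [set T | bounded_op T /\ forall S, M S -> T \o S = S \o T].

Definition central_projection M z : Prop :=
  [/\ projection z, M z & commutant M z].

Definition abelian_projection M e : Prop :=
  [/\ projection e, M e & forall S T, M S -> M T ->
    (e \o S \o e) \o (e \o T \o e) = (e \o T \o e) \o (e \o S \o e)].

(* For projections, [z \o e = e] is [e <= z]. *)
Definition typeI_von_neumann M : Prop :=
  forall z, central_projection M z -> z <> (fun=> 0) ->
  exists e, [/\ abelian_projection M e, e <> (fun=> 0) & z \o e = e].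

End Operators.

Section HilbertTheory.
Context {R : realType} {H : hilbertType R}.
Implicit Types (x y z : H) (S T : H -> H).

Lemma innerDl x y z : inner (x + y) z = inner x z + inner y z.
Proof. by rewrite -{1}[x]scale1r inner_linearl mul1r. Qed.

Lemma inner0l z : inner 0 z = 0.
Proof. by apply: (addrI (inner 0 z)); rewrite -innerDl !addr0. Qed.

Lemma innerZl (a : R[i]) x z : inner (a *: x) z = a * inner x z.
Proof. by rewrite -[a *: x]addr0 inner_linearl inner0l addr0. Qed.

Lemma innerDr x y z : inner x (y + z) = inner x y + inner x z.
Proof.
by rewrite inner_conj innerDl rmorphD/= -!inner_conj.
Qed.

Lemma innerZr (a : R[i]) x z : inner x (a *: z) = a^* * inner x z.
Proof.
by rewrite inner_conj innerZl rmorphM/= -inner_conj.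
Qed.

Lemma innerBr x y z : inner x (y - z) = inner x y - inner x z.
Proof. by rewrite innerDr -scaleN1r innerZr rmorphN/= rmorph1 mulN1r. Qed.

Lemma inner_eq y z : (forall x, inner x y = inner x z) -> y = z.
Proof.
move=> yz; apply/subr0_eq/eqP; rewrite -normr_eq0 -sqrf_eq0 -inner_norm.
by rewrite innerBr yz subrr.
Qed.

Lemma cauchy_schwarz x y : `|inner x y| <= `|x| * `|y|.
Proof.
have [->|y0] := eqVneq y 0.
  by rewrite inner_conj inner0l rmorph0 !normr0 mulr0.
rewrite -ler_sqr ?nnegrE ?mulr_ge0// exprMn -!inner_norm normCK.
set a := inner x y; set n := inner y y.
have n0 : 0 < n by rewrite /n inner_norm exprn_gt0 ?normr_gt0.
have nJ : n^* = n by rewrite /n -inner_conj.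
have : 0 <= inner (n *: x + - a *: y) (n *: x + - a *: y).
  by rewrite inner_norm exprn_ge0.
rewrite innerDl !innerDr !innerZl !innerZr nJ (inner_conj x y).
rewrite -/a -/n (_ : (- a)^* = - a^*); last exact: rmorphN.
have -> : n * (n * inner x x) + n * (- a^* * a) +
    (- a * (n * a^*) + - a * (- a^* * n)) = n * (inner x x * n - a * a^*).
  by ring.
by rewrite pmulr_rge0// subr_ge0.
Qed.

Lemma bounded_opP T : linear T ->
  (exists M : R, forall x, `|T x| <= M%:C * `|x|) -> bounded_op T.
Proof.
move=> Tlin [M TM]; split=> //.
pose A : {linear H -> H} := HB.pack T (GRing.isLinear.Build _ _ _ _ _ Tlin).
apply: (@bounded_linear_continuous _ _ _ A); apply/linear_boundedP.
exists M%:C; split; first by apply/complex_realP; exists M.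
move=> r r1 f; apply: le_trans (TM f) _.
by rewrite ler_wpM2r// ltW.
Qed.

Lemma bounded_op_bound T : bounded_op T ->
  exists2 M : R, 0 < M & forall x, `|T x| <= M%:C * `|x|.
Proof.
move=> [Tlin Tc].
pose A : {linear H -> H} := HB.pack T (GRing.isLinear.Build _ _ _ _ _ Tlin).
have /linear_boundedP/pinfty_ex_gt0[m m0 mP] : bounded_near A (nbhs (0 : H)).
  by apply: continuous_linear_bounded; exact: Tc.
have /complex_realP[M ME] : m \is Num.real by exact: gtr0_real.
by exists M; [rewrite -ltcR -ME|rewrite -ME].
Qed.

Lemma adjoint_bounded S T : bounded_op S -> adjoint_of S T -> bounded_op T.
Proof.
move=> Sb ST; apply: bounded_opP.
  move=> a y z; apply: inner_eq => x.
  by rewrite innerDr innerZr -!ST innerDr innerZr.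
have [M M0 SM] := bounded_op_bound Sb; exists M => y.
have [->|Ty0] := eqVneq (T y) 0; first by rewrite normr0 mulr_ge0// lecR ltW.
have t0 : 0 < `|T y| by rewrite normr_gt0.
rewrite -(ler_pM2l t0) -expr2 -inner_norm -ST -[leLHS]ger0_norm; last first.
  by rewrite ST inner_norm exprn_ge0.
apply: le_trans (cauchy_schwarz _ _) _.
by rewrite mulrA ler_wpM2r// mulrC SM.
Qed.

Lemma cstar_subalgebra_bounded : cstar_subalgebra (@bounded_op R H).
Proof.
split=> //.
- by apply: bounded_opP; [move=> a x y; rewrite scaler0 addr0|
    exists 0 => x; rewrite normr0 mul0r].
- move=> a S T Sb Tb; have [L L0 SL] := bounded_op_bound Sb.
  have [M M0 TM] := bounded_op_bound Tb.
  case: Sb Tb => Sl _ [Tl _]; apply: bounded_opP.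
    move=> c x y; rewrite Sl Tl !scalerDr !scalerA (mulrC a c).
    by rewrite addrACA.
  have /complex_realP[K KE] : `|a| \is Num.real by exact: normr_real.
  exists (K * L + M) => x; apply: le_trans (ler_normD _ _) _.
  rewrite normrZ rmorphD rmorphM/= -KE mulrDl lerD// -mulrA.
  by rewrite ler_wpM2l.
- move=> S T Sb Tb; have [L L0 SL] := bounded_op_bound Sb.
  have [M M0 TM] := bounded_op_bound Tb.
  case: Sb Tb => Sl _ [Tl _]; apply: bounded_opP.
    by move=> c x y; rewrite /= Tl Sl.
  exists (L * M) => x; apply: le_trans (SL _) _.
  by rewrite rmorphM/= -mulrA ler_wpM2l// lecR ltW.
- by move=> S T; exact: adjoint_bounded.
Qed.

Lemma cstar_generatedP (G : set (H -> H)) :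
  G `<=` bounded_op -> cstar_subalgebra (cstar_generated G).
Proof.
move=> Gb; have sub : cstar_generated G `<=` @bounded_op R H.
  by apply: smallest_sub => //; exact: cstar_subalgebra_bounded.
split=> //.
- by move=> A [cA GA]; exact: cstar_zero.
- move=> a S T SG TG A [cA GA].
  by apply: (cstar_linear cA); [exact: SG|exact: TG].
- move=> S T SG TG A [cA GA].
  by apply: (cstar_mul cA); [exact: SG|exact: TG].
- move=> S T SG ST A [cA GA].
  by apply: (cstar_adjoint cA _ ST); exact: SG.
- move=> T Tb TG A [cA GA]; apply: (cstar_closed cA) => // eps /TG[S SG Seps].
  by exists S => //; exact: SG.
Qed.

End HilbertTheory.

Section Representations.
Context {R : realType} {F : hilbertType R}.

(* [rho] is only meaningful on [A]; its values outside of [A] are irrelevant. *)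
Record star_representation (A : set (F -> F)) (H : hilbertType R)
    (rho : (F -> F) -> (H -> H)) : Prop := {
  rep_bounded : forall T, A T -> bounded_op (rho T);
  rep_linear : forall (a : R[i]) S T, A S -> A T ->
    rho (fun x => a *: S x + T x) = (fun y => a *: rho S y + rho T y);
  rep_mul : forall S T, A S -> A T -> rho (S \o T) = rho S \o rho T;
  rep_adjoint : forall S T, A S -> A T ->
    adjoint_of S T -> adjoint_of (rho S) (rho T)
}.

Definition nondegenerate (A : set (F -> F)) (H : hilbertType R)
    (rho : (F -> F) -> (H -> H)) : Prop :=
  dense [set y : H | exists n (T : 'I_n -> F -> F) (x : 'I_n -> H),
    (forall k, A (T k)) /\ y = \sum_(k < n) rho (T k) (x k)].

(* A C*-algebra is of type I when the von Neumann algebra generated by each of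
   its nondegenerate representations is of type I. *)
Definition typeI_cstar (A : set (F -> F)) : Prop :=
  forall (H : hilbertType R) (rho : (F -> F) -> (H -> H)),
    star_representation A rho -> nondegenerate A rho ->
    typeI_von_neumann (commutant (commutant (rho @` A))).

End Representations.

Section Sums.
Context {R : realType} {I : choiceType}.
Implicit Types (a b h : I -> R).

Definition rsummable h : Prop := summable setT (EFin \o h).

Definition nnsum a : R := fine (\esum_(i in [set: I]) (a i)%:E).

Definition rsum h : R :=
  nnsum (fun i => Num.max (h i) 0) - nnsum (fun i => Num.max (- h i) 0).

Lemma rsummable_le a h : rsummable a -> (forall i, `|h i| <= `|a i|) ->
  rsummable h.
Proof.
move=> sa ha; apply: le_lt_trans sa; apply: le_esum => i _ /=.
by rewrite lee_fin.
Qed.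

Lemma rsummableD a b : rsummable a -> rsummable b ->
  rsummable (fun i => a i + b i).
Proof. exact: summableD. Qed.

Lemma nnsum_fin a : rsummable a -> (forall i, 0 <= a i) ->
  (nnsum a)%:E = \esum_(i in [set: I]) (a i)%:E.
Proof.
move=> sa a0; rewrite /nnsum fineK//.
move: sa; rewrite /rsummable summableE.
congr (_ \is a fin_num); apply: eq_esum => i _ /=.
by rewrite ger0_norm.
Qed.

Lemma nnsum_eq a b : (forall i, a i = b i) -> nnsum a = nnsum b.
Proof. by move=> ab; congr nnsum; apply/funext. Qed.

Lemma nnsum_ge0 a : (forall i, 0 <= a i) -> 0 <= nnsum a.
Proof.
by move=> a0; apply: fine_ge0; apply: esum_ge0 => i _; rewrite lee_fin.
Qed.

Lemma nnsumD a b : rsummable a -> rsummable b -> (forall i, 0 <= a i) ->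
  (forall i, 0 <= b i) -> nnsum (fun i => a i + b i) = nnsum a + nnsum b.
Proof.
move=> sa sb a0 b0; apply: EFin_inj.
rewrite EFinD !nnsum_fin//; last 2 first.
- exact: rsummableD.
- by move=> i; rewrite addr_ge0.
by rewrite -esumD// => i _; rewrite lee_fin.
Qed.

Lemma nnsum_ge a (s : {fset I}) : rsummable a -> (forall i, 0 <= a i) ->
  \sum_(i <- s) a i <= nnsum a.
Proof.
move=> sa a0; rewrite -lee_fin nnsum_fin//.
apply: esum_ge; exists [set` s]; first by split=> //; exact: finite_fset.
by rewrite fsbig_finite ?set_fsetK ?sumEFin//=; exact: finite_fset.
Qed.

Lemma nnsum_le a (M : R) : (forall i, 0 <= a i) ->
  (forall s : {fset I}, \sum_(i <- s) a i <= M) ->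
  rsummable a /\ nnsum a <= M.
Proof.
move=> a0 aM.
have le : (\esum_(i in [set: I]) (a i)%:E <= M%:E)%E.
  apply: ge_ereal_sup => _ [X [finX _] <-].
  by rewrite fsbig_finite//= sumEFin lee_fin.
have sa : rsummable a.
  rewrite /rsummable /summable; apply: le_lt_trans (ltry M).
  apply: le_trans le; apply: le_esum => i _ /=.
  by rewrite ger0_norm.
by split=> //; rewrite -lee_fin nnsum_fin.
Qed.

Lemma nnsum_le2 a b : rsummable b -> (forall i, 0 <= a i <= b i) ->
  nnsum a <= nnsum b.
Proof.
move=> sb ab.
have b0 i : 0 <= b i by have /andP[/le_trans] := ab i; apply.
apply: (proj2 (nnsum_le _ _)) => [i|s]; first by have /andP[] := ab i.
apply: le_trans (nnsum_ge s sb b0); apply: ler_sum => i _.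
by have /andP[] := ab i.
Qed.

Lemma rsummableZ (c : R) h : rsummable h -> rsummable (fun i => c * h i).
Proof.
move=> sh.
have sh' : rsummable (fun i => `|h i|).
  by apply: rsummable_le sh _ => i; rewrite normr_id.
have [] := @nnsum_le (fun i => `|c * h i|) (`|c| * nnsum (fun i => `|h i|)).
- by [].
- move=> s; under eq_bigr do rewrite normrM.
  by rewrite -mulr_sumr ler_wpM2l// nnsum_ge.
by move=> sc _; apply: rsummable_le sc _ => i; rewrite normr_id.
Qed.

Lemma nnsumZ (c : R) a : 0 <= c -> rsummable a -> (forall i, 0 <= a i) ->
  nnsum (fun i => c * a i) = c * nnsum a.
Proof.
move=> c0 sa a0; apply/eqP; rewrite eq_le.
have ca0 i : 0 <= c * a i by rewrite mulr_ge0.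
apply/andP; split.
  apply: (proj2 (nnsum_le _ _)) => // s.
  by rewrite -mulr_sumr ler_wpM2l// nnsum_ge.
have [->|c1] := eqVneq c 0.
  by rewrite mul0r nnsum_ge0// => i; rewrite mul0r.
have cp : 0 < c by rewrite lt_neqAle eq_sym c1.
rewrite -ler_pdivlMl//; apply: (proj2 (nnsum_le _ _)) => // s.
rewrite ler_pdivlMl// mulr_sumr.
by apply: (nnsum_ge s (rsummableZ c sa)).
Qed.

Lemma rsummable_pos h : rsummable h -> rsummable (fun i => Num.max (h i) 0).
Proof.
move=> sh; apply: rsummable_le sh _ => i.
by case: (leP (h i) 0) => // _; rewrite normr0.
Qed.

Lemma rsummable_neg h : rsummable h -> rsummable (fun i => Num.max (- h i) 0).
Proof.
move=> sh; apply: rsummable_le sh _ => i.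
by case: (leP (- h i) 0) => // _; rewrite ?normr0 ?normrN.
Qed.

Lemma rsumB a b h : rsummable a -> rsummable b -> (forall i, 0 <= a i) ->
  (forall i, 0 <= b i) -> (forall i, h i = a i - b i) ->
  rsum h = nnsum a - nnsum b.
Proof.
move=> sa sb a0 b0 hab.
have sh : rsummable h.
  apply: (@rsummable_le (fun i => a i + b i)); first exact: rsummableD.
  move=> i; rewrite hab [leRHS]ger0_norm ?addr_ge0//.
  by rewrite (le_trans (ler_normB _ _))// !ger0_norm.
have p0 i : 0 <= Num.max (h i) 0 by rewrite le_max lexx orbT.
have n0 i : 0 <= Num.max (- h i) 0 by rewrite le_max lexx orbT.
have : nnsum (fun i => Num.max (h i) 0) + nnsum b =
       nnsum (fun i => Num.max (- h i) 0) + nnsum a.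
  rewrite -!nnsumD//.
  - apply: nnsum_eq => i; rewrite hab.
    by case: (leP (a i - b i) 0); case: (leP (- (a i - b i)) 0); lra.
  - exact: rsummable_neg.
  - exact: rsummable_pos.
by rewrite /rsum; lra.
Qed.

Lemma rsumD h k : rsummable h -> rsummable k ->
  rsum (fun i => h i + k i) = rsum h + rsum k.
Proof.
move=> sh sk.
have p0 (f : I -> R) i : 0 <= Num.max (f i) 0 by rewrite le_max lexx orbT.
have n0 (f : I -> R) i : 0 <= Num.max (- f i) 0 by rewrite le_max lexx orbT.
have pn (f : I -> R) i : f i = Num.max (f i) 0 - Num.max (- f i) 0.
  by case: (leP (f i) 0); case: (leP (- f i) 0); lra.
rewrite (@rsumB (fun i => Num.max (h i) 0 + Num.max (k i) 0)
  (fun i => Num.max (- h i) 0 + Num.max (- k i) 0)).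
- rewrite !nnsumD//; try exact: rsummable_pos; try exact: rsummable_neg.
  by rewrite /rsum; lra.
- by apply: rsummableD; exact: rsummable_pos.
- by apply: rsummableD; exact: rsummable_neg.
- by move=> i; rewrite addr_ge0.
- by move=> i; rewrite addr_ge0.
- by move=> i; rewrite {1}(pn h) {1}(pn k); lra.
Qed.

Lemma rsumN h : rsum (fun i => - h i) = - rsum h.
Proof.
rewrite /rsum opprB; congr (_ - _); apply: nnsum_eq => i.
by rewrite opprK.
Qed.

Lemma rsum_ge0 h : (forall i, 0 <= h i) -> rsum h = nnsum h.
Proof.
move=> h0; rewrite /rsum [X in _ - X](_ : _ = 0) ?subr0.
  by apply: nnsum_eq => i; apply/max_idPl.
rewrite /nnsum esum1// => i _; congr (_%:E); apply/max_idPr.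
by rewrite oppr_le0.
Qed.

Lemma rsumZ (c : R) h : rsummable h -> rsum (fun i => c * h i) = c * rsum h.
Proof.
wlog c0 : c / 0 <= c => [th|].
  have [/th//|/ltW c0 sh] := leP 0 c.
  rewrite -[c]opprK mulNr -th ?oppr_ge0// -rsumN.
  by congr rsum; apply/funext => i; rewrite mulNr.
move=> sh.
have p0 (f : I -> R) i : 0 <= Num.max (f i) 0 by rewrite le_max lexx orbT.
have pn (f : I -> R) i : f i = Num.max (f i) 0 - Num.max (- f i) 0.
  by case: (leP (f i) 0); case: (leP (- f i) 0); lra.
have n0 i : 0 <= Num.max (- h i) 0 by exact: (p0 (fun i => - h i)).
rewrite (@rsumB (fun i => c * Num.max (h i) 0)
  (fun i => c * Num.max (- h i) 0)).
- rewrite !nnsumZ//; last 2 first.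
  + exact: rsummable_neg.
  + exact: rsummable_pos.
  by rewrite /rsum mulrBr.
- by apply: rsummableZ; exact: rsummable_pos.
- by apply: rsummableZ; exact: rsummable_neg.
- by move=> i; rewrite mulr_ge0.
- by move=> i; rewrite mulr_ge0.
- by move=> i; rewrite -mulrBr -pn.
Qed.

End Sums.

Section SquareModulus.
Context {R : realType}.
Implicit Types u v c : R[i].

Definition sqmod u : R := complex.Re u ^+ 2 + complex.Im u ^+ 2.

Lemma sqmod_ge0 u : 0 <= sqmod u.
Proof. by rewrite addr_ge0 ?sqr_ge0. Qed.

Lemma sqmod0 : sqmod 0 = 0.
Proof. by rewrite /sqmod /= !expr0n addr0. Qed.

Lemma sqmod_eq0 u : sqmod u = 0 -> u = 0.
Proof.
case: u => a b; rewrite /sqmod/= => /eqP.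
by rewrite paddr_eq0 ?sqr_ge0// !sqrf_eq0 => /andP[/eqP -> /eqP ->].
Qed.

Lemma sqmodM c u : sqmod (c * u) = sqmod c * sqmod u.
Proof. by case: c u => a b [d e]; rewrite /sqmod/=; ring. Qed.

Lemma sqmodE u : (sqmod u)%:C = u * u^*.
Proof.
case: u => a b; rewrite /sqmod; simpc; congr (_ +i* _); ring.
Qed.

Lemma normc_sqmod u : `|u| = (Num.sqrt (sqmod u))%:C.
Proof. exact: normc_def. Qed.

Lemma sqmodD_le t u v : 0 < t ->
  sqmod (u + v) <= (1 + t) * sqmod u + (1 + t^-1) * sqmod v.
Proof.
move=> t0; rewrite -subr_ge0.
have -> : (1 + t) * sqmod u + (1 + t^-1) * sqmod v - sqmod (u + v) =
    t^-1 * ((t * complex.Re u - complex.Re v) ^+ 2 +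
            (t * complex.Im u - complex.Im v) ^+ 2).
  by case: u v => a b [d e]; rewrite /sqmod/=; field; lra.
by apply: mulr_ge0; [rewrite invr_ge0 ltW|rewrite addr_ge0 ?sqr_ge0].
Qed.

Lemma sqmodB_le u v : sqmod (u - v) <= 2 * sqmod u + 2 * sqmod v.
Proof.
rewrite -subr_ge0 /sqmod; case: u v => a b [d e] /=.
have -> : 2 * (a ^+ 2 + b ^+ 2) + 2 * (d ^+ 2 + e ^+ 2) -
  ((a - d) ^+ 2 + (b - e) ^+ 2) = (a + d) ^+ 2 + (b + e) ^+ 2 by ring.
by rewrite addr_ge0 ?sqr_ge0.
Qed.

Lemma ReM_conj_le u v : `|complex.Re (u * v^*)| <= sqmod u + sqmod v.
Proof.
case: u v => a b [d e]; rewrite /sqmod/= ler_norml.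
have := sqr_ge0 (a + d); have := sqr_ge0 (b + e).
have := sqr_ge0 (a - d); have := sqr_ge0 (b - e).
have := sqr_ge0 a; have := sqr_ge0 b; have := sqr_ge0 d; have := sqr_ge0 e.
by move=> *; apply/andP; split; nra.
Qed.

Lemma ImM_conj_le u v : `|complex.Im (u * v^*)| <= sqmod u + sqmod v.
Proof.
case: u v => a b [d e]; rewrite /sqmod/= ler_norml.
have := sqr_ge0 (a + e); have := sqr_ge0 (b + d).
have := sqr_ge0 (a - e); have := sqr_ge0 (b - d).
have := sqr_ge0 a; have := sqr_ge0 b; have := sqr_ge0 d; have := sqr_ge0 e.
by move=> *; apply/andP; split; nra.
Qed.

End SquareModulus.

Definition square_summable {R : realType} {I : choiceType} :
    {pred I -> R[i]} :=
  fun f => summable setT (fun i => (sqmod (f i))%:E).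

Record ell2 (R : realType) (I : choiceType) := Ell2 {
  ell2_val :> I -> R[i];
  ell2_valP : ell2_val \in square_summable
}.
Arguments Ell2 {R I}.

Section Ell2Lmodule.
Context {R : realType} {I : choiceType}.

HB.instance Definition _ := [isSub for @ell2_val R I].
HB.instance Definition _ := [Choice of ell2 R I by <:].

Lemma square_summable_submod :
  submod_closed (@square_summable R I).
Proof.
split.
  rewrite unfold_in /square_summable /summable esum1 ?ltry// => i _.
  by rewrite sqmod0 /= normr0.
move=> c f g; rewrite !unfold_in => sf sg.
have : rsummable (fun i => sqmod c * (2 * sqmod (f i)) + 2 * sqmod (g i)).
  apply: (@rsummableD _ _ (fun i => _ * (_ * _)) (fun i => _ * _)).
    by do 2 apply: rsummableZ.
  exact: rsummableZ.
move=> h; apply: (rsummable_le h) => i.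
rewrite [leRHS]ger0_norm ?addr_ge0 ?mulr_ge0 ?sqmod_ge0// ger0_norm ?sqmod_ge0//.
have := sqmodB_le (c * f i) (- g i).
rewrite opprK sqmodM (_ : sqmod (- g i) = sqmod (g i)); first by lra.
by case: (g i) => a b; rewrite /sqmod/= !sqrrN.
Qed.

HB.instance Definition _ :=
  GRing.isSubmodClosed.Build _ _ (@square_summable R I)
    square_summable_submod.
HB.instance Definition _ := [SubChoice_isSubLmodule of ell2 R I by <:].

Implicit Types f g : ell2 R I.

Lemma ell2P f g : (forall i, f i = g i) -> f = g.
Proof. by move=> fg; apply: val_inj; apply/funext. Qed.

Lemma ell2D f g i : (f + g) i = f i + g i.
Proof. by []. Qed.

Lemma ell2B f g i : (f - g) i = f i - g i.
Proof. by []. Qed.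

Lemma ell2Z (c : R[i]) f i : (c *: f) i = c * f i.
Proof. by []. Qed.

Lemma ell2_summable f : rsummable (fun i => sqmod (f i)).
Proof. exact: ell2_valP. Qed.

Definition ell2_sqnorm f : R := nnsum (fun i => sqmod (f i)).

Lemma ell2_sqnorm_ge0 f : 0 <= ell2_sqnorm f.
Proof. by apply: nnsum_ge0 => i; exact: sqmod_ge0. Qed.

Lemma ell2_coord_le f i : sqmod (f i) <= ell2_sqnorm f.
Proof.
have := nnsum_ge [fset i]%fset (ell2_summable f) (fun i => sqmod_ge0 _).
by rewrite big_seq_fset1.
Qed.

Definition ell2_norm f : R[i] := (Num.sqrt (ell2_sqnorm f))%:C.

Lemma ell2_norm_triangle f g : ell2_norm (f + g) <= ell2_norm f + ell2_norm g.
Proof.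
have z0 h : ell2_sqnorm h = 0 -> h = 0.
  move=> h0; apply: ell2P => i; apply: sqmod_eq0; apply/eqP.
  by rewrite eq_le sqmod_ge0 andbT -h0 ell2_coord_le.
rewrite /ell2_norm -rmorphD lecR.
have [/z0 ->|f0] := eqVneq (ell2_sqnorm f) 0.
  by rewrite add0r lerDr sqrtr_ge0.
have [/z0 ->|g0] := eqVneq (ell2_sqnorm g) 0.
  by rewrite addr0 lerDl sqrtr_ge0.
set a := Num.sqrt (ell2_sqnorm f); set b := Num.sqrt (ell2_sqnorm g).
have a0 : 0 < a by rewrite sqrtr_gt0 lt_neqAle eq_sym f0 ell2_sqnorm_ge0.
have b0 : 0 < b by rewrite sqrtr_gt0 lt_neqAle eq_sym g0 ell2_sqnorm_ge0.
have -> : a + b = Num.sqrt ((a + b) ^+ 2).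
  by rewrite sqrtr_sqr ger0_norm// addr_ge0 ?ltW.
apply: ler_wsqrtr.
have t0 : 0 < b / a by rewrite divr_gt0.
pose m i := (1 + b / a) * sqmod (f i) + (1 + (b / a)^-1) * sqmod (g i).
have sf := ell2_summable f; have sg := ell2_summable g.
have c0 : 0 <= 1 + b / a by lra.
have d0 : 0 <= 1 + (b / a)^-1 by rewrite addr_ge0 ?invr_ge0 ?ltW.
have : ell2_sqnorm (f + g) <= nnsum m.
  apply: nnsum_le2.
    by apply: rsummableD; exact: rsummableZ.
  by move=> i; rewrite sqmod_ge0 ell2D sqmodD_le.
move=> /le_trans; apply.
rewrite /m nnsumD//; try exact: rsummableZ;
  try by move=> i; rewrite mulr_ge0 ?sqmod_ge0.
rewrite !nnsumZ//; try by move=> i; exact: sqmod_ge0.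
rewrite -/(ell2_sqnorm f) -/(ell2_sqnorm g).
have -> : ell2_sqnorm f = a ^+ 2 by rewrite sqr_sqrtr ?ell2_sqnorm_ge0.
have -> : ell2_sqnorm g = b ^+ 2 by rewrite sqr_sqrtr ?ell2_sqnorm_ge0.
by rewrite le_eqVlt; apply/orP; left; apply/eqP; field; lra.
Qed.

Lemma ell2_sqnormZ (c : R[i]) f :
  ell2_sqnorm (c *: f) = sqmod c * ell2_sqnorm f.
Proof.
have f0 i : 0 <= sqmod (f i) by exact: sqmod_ge0.
rewrite /ell2_sqnorm -(nnsumZ (sqmod_ge0 c) (ell2_summable f) f0).
by apply: nnsum_eq => i; rewrite ell2Z sqmodM.
Qed.

Lemma ell2_normZ (c : R[i]) f : ell2_norm (c *: f) = `|c| * ell2_norm f.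
Proof.
by rewrite /ell2_norm ell2_sqnormZ sqrtrM ?sqmod_ge0// normc_sqmod rmorphM.
Qed.

Lemma ell2_norm_eq0 f : ell2_norm f = 0 -> f = 0.
Proof.
move=> /complexI/eqP; rewrite sqrtr_eq0 => f0.
apply: ell2P => i; apply: sqmod_eq0; apply/eqP.
by rewrite eq_le sqmod_ge0 andbT (le_trans (ell2_coord_le f i)).
Qed.

HB.instance Definition _ := Lmodule_isNormed.Build R[i] (ell2 R I)
  ell2_norm_triangle ell2_normZ ell2_norm_eq0.

Lemma ell2_normE f : `|f| = (Num.sqrt (ell2_sqnorm f))%:C.
Proof. by []. Qed.

End Ell2Lmodule.

Section Ell2Hilbert.
Context {R : realType} {I : choiceType}.
Implicit Types f g h : ell2 R I.

Lemma ell2_normB_lt f g (e : R) : 0 < e ->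
  (`|f - g| < e%:C) = (ell2_sqnorm (f - g) < e ^+ 2).
Proof.
move=> e0; rewrite ell2_normE ltcR -[in LHS](ger0_norm (ltW e0)) -sqrtr_sqr.
by rewrite ltr_sqrt// exprn_gt0.
Qed.

Lemma ell2_normB_le f g (e : R) : 0 <= e -> ell2_sqnorm (f - g) <= e ^+ 2 ->
  `|f - g| <= e%:C.
Proof.
move=> e0 fg; rewrite ell2_normE lecR -[leRHS](ger0_norm e0) -sqrtr_sqr.
exact: ler_wsqrtr.
Qed.

Lemma ell2_complete (F : set_system (ell2 R I)) :
  ProperFilter F -> cauchy F -> cvg F.
Proof.
move=> FF FC.
have Fe (e : R) : 0 < e ->
    exists x, \forall y \near F, ell2_sqnorm (x - y) < e ^+ 2.
  move=> e0; have e0C : 0 < e%:C :> R[i] by rewrite ltcR.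
  have [x Fx] := (cauchyP F).1 FC _ e0C.
  exists x; apply: filterS Fx => y.
  by rewrite -ball_normE /ball_/= ell2_normB_lt.
have Fcvg (phi : R[i] -> R) j :
    (forall u v, (phi u - phi v) ^+ 2 <= sqmod (u - v)) ->
    cvg ((fun y : ell2 R I => phi (y j)) @ F).
  move=> phiP; apply: cauchy_cvg; apply: cauchy_exP => e e0.
  have [x Fx] := Fe _ e0.
  exists (phi (x j)); apply: filterS Fx => y xy.
  rewrite -ball_normE /ball_/= -ltr_sqr ?nnegrE ?(ltW e0)//.
  rewrite real_normK ?num_real//; apply: le_lt_trans (phiP _ _) _.
  by apply: le_lt_trans xy; rewrite -ell2B; exact: ell2_coord_le.
have FRe : forall j, cvg ((fun y : ell2 R I => complex.Re (y j)) @ F).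
  move=> j; apply: Fcvg => -[a b] [c d]; rewrite /sqmod/= lerDl; exact: sqr_ge0.
have FIm : forall j, cvg ((fun y : ell2 R I => complex.Im (y j)) @ F).
  move=> j; apply: Fcvg => -[a b] [c d]; rewrite /sqmod/= lerDr; exact: sqr_ge0.
pose g i : R[i] := lim ((fun y : ell2 R I => complex.Re (y i)) @ F) +i*
                   lim ((fun y : ell2 R I => complex.Im (y i)) @ F).
have gP (x : ell2 R I) (M : R) :
    (\forall y \near F, ell2_sqnorm (x - y) < M) ->
    rsummable (fun i => sqmod (x i - g i)) /\
    nnsum (fun i => sqmod (x i - g i)) <= M.
  move=> FM; apply: nnsum_le => [i|s]; first exact: sqmod_ge0.
  apply: (@cvgr_to_le _ F _ _
    (fun y : ell2 R I => \sum_(i <- s) sqmod (x i - y i))); last first.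
    apply: filterS FM => y /ltW; apply: le_trans.
    under eq_bigr do rewrite -ell2B.
    apply: (nnsum_ge s (ell2_summable (x - y))) => i; exact: sqmod_ge0.
  apply: (cvg_big (op := +%R) (P := xpredT)); first exact: add_continuous.
  move=> i _.
  have sqE (u : R[i]) : sqmod (x i - u) =
      (complex.Re (x i) - complex.Re u) * (complex.Re (x i) - complex.Re u) +
      (complex.Im (x i) - complex.Im u) * (complex.Im (x i) - complex.Im u).
    by case: (x i) u => a b [c d]; rewrite /sqmod/= !expr2.
  rewrite sqE; under eq_fun do rewrite sqE.
  have cRe : (fun y : ell2 R I => complex.Re (x i) - complex.Re (y i)) @ F -->
      complex.Re (x i) - complex.Re (g i).
    by apply: cvgB; [exact: cvg_cst|exact: FRe].
  have cIm : (fun y : ell2 R I => complex.Im (x i) - complex.Im (y i)) @ F -->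
      complex.Im (x i) - complex.Im (g i).
    by apply: cvgB; [exact: cvg_cst|exact: FIm].
  by apply: cvgD; apply: cvgM.
have [x1 Fx1] := Fe 1 ltr01.
have x1g : (fun i => x1 i - g i) \in @square_summable R I.
  exact: (gP _ _ Fx1).1.
pose G : ell2 R I := x1 - Ell2 _ x1g.
have GE i : G i = g i by rewrite ell2B/= subKr.
apply/cvg_ex; exists G; apply/cvgrPdist_le => eps eps0.
have [e epsE] : exists e : R, eps = e%:C.
  by apply/complex_realP; exact: gtr0_real.
move: eps0; rewrite epsE ltcR => e0.
have e20 : 0 < e / 2 by rewrite divr_gt0.
have [x Fx] := Fe _ e20.
have xG : `|x - G| <= (e / 2)%:C.
  apply: ell2_normB_le; first exact: ltW.
  rewrite /ell2_sqnorm; under eq_fun do rewrite ell2B GE.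
  exact: (gP _ _ Fx).2.
apply: filterS Fx => y; rewrite -ell2_normB_lt// => /ltW xy.
rewrite -(subrKA x) [e]splitr rmorphD.
by apply: le_trans (ler_normD _ _) _; rewrite lerD// distrC.
Qed.

HB.instance Definition _ := Uniform_isComplete.Build (ell2 R I) ell2_complete.

(* The sum is taken over the index set, unconditionally and absolutely
   convergent. *)
Definition ell2_inner f g : R[i] :=
  rsum (fun i => complex.Re (f i * (g i)^*)) +i*
  rsum (fun i => complex.Im (f i * (g i)^*)).

Lemma rsummable_Re f g : rsummable (fun i => complex.Re (f i * (g i)^*)).
Proof.
have h := rsummableD (ell2_summable f) (ell2_summable g).
apply: (rsummable_le h) => i.
rewrite [leRHS]ger0_norm; last by apply: addr_ge0; exact: sqmod_ge0.
exact: ReM_conj_le.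
Qed.

Lemma rsummable_Im f g : rsummable (fun i => complex.Im (f i * (g i)^*)).
Proof.
have h := rsummableD (ell2_summable f) (ell2_summable g).
apply: (rsummable_le h) => i.
rewrite [leRHS]ger0_norm; last by apply: addr_ge0; exact: sqmod_ge0.
exact: ImM_conj_le.
Qed.

Lemma rsum_lin (a b : R) (h1 h2 h3 : I -> R) :
  rsummable h1 -> rsummable h2 -> rsummable h3 ->
  rsum (fun i => a * h1 i + b * h2 i + h3 i) =
  a * rsum h1 + b * rsum h2 + rsum h3.
Proof.
move=> s1 s2 s3.
have t1 := rsummableZ a s1; have t2 := rsummableZ b s2.
by rewrite rsumD ?rsumD ?rsumZ//; exact: rsummableD.
Qed.

Lemma ell2_inner_linearl (c : R[i]) f g h :
  ell2_inner (c *: f + g) h = c * ell2_inner f h + ell2_inner g h.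
Proof.
case: c => a b; rewrite /ell2_inner; simpc.
have sRe := rsummable_Re f h; have sIm := rsummable_Im f h.
congr (_ +i* _).
  rewrite -mulNr -rsum_lin//; last exact: rsummable_Re.
  congr rsum; apply/funext => j; rewrite ell2D ell2Z.
  by case: (f j) (g j) (h j) => x y [z t] [u v] /=; ring.
rewrite -rsum_lin//; last exact: rsummable_Im.
congr rsum; apply/funext => j; rewrite ell2D ell2Z.
by case: (f j) (g j) (h j) => x y [z t] [u v] /=; ring.
Qed.

Lemma ell2_inner_conj f g : ell2_inner g f = (ell2_inner f g)^*.
Proof.
apply/eqP; rewrite eq_complex /= -rsumN.
apply/andP; split; apply/eqP; congr rsum.
  by apply/funext => j; case: (f j) (g j) => x y [z t] /=; ring.
by apply/funext => j; case: (f j) (g j) => x y [z t] /=; ring.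
Qed.

Lemma ell2_inner_norm f : ell2_inner f f = `|f| ^+ 2.
Proof.
rewrite ell2_normE -rmorphXn/= sqr_sqrtr ?ell2_sqnorm_ge0//.
rewrite /ell2_inner /ell2_sqnorm; congr (_ +i* _).
  rewrite -rsum_ge0; last by move=> j; exact: sqmod_ge0.
  by congr rsum; apply/funext => j; rewrite -sqmodE.
rewrite rsum_ge0; last by move=> j; rewrite -sqmodE.
by rewrite /nnsum esum1// => j _; rewrite -sqmodE.
Qed.

HB.instance Definition _ := CompleteNormedModule_isHilbert.Build R (ell2 R I)
  ell2_inner_linearl ell2_inner_conj ell2_inner_norm.

Lemma square_summable_delta (w : I) :
  (fun v : I => (v == w)%:R : R[i]) \in @square_summable R I.
Proof.
rewrite unfold_in /square_summable /summable.
rewrite (esumID [set w])// setTI esum_set1// esum1 ?adde0 ?ltry// => v [_ /= vw].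
by rewrite (introF eqP vw) sqmod0 normr0.
Qed.

Definition ell2_delta (w : I) : ell2 R I := Ell2 _ (square_summable_delta w).

Lemma inner_delta f w : inner f (ell2_delta w) = f w.
Proof.
have sum1 (h : I -> R) : (forall v, v != w -> h v = 0) -> rsum h = h w.
  have nn1 (k : I -> R) : (forall v, 0 <= k v) ->
      (forall v, v != w -> k v = 0) -> nnsum k = k w.
    move=> k0 kw; rewrite /nnsum (esumID [set w]) ?setTI ?esum_set1 ?lee_fin//.
      rewrite esum1 ?adde0// => v /= vw.
      by rewrite kw//; apply/negP => /eqP /vw.
    by move=> v _; rewrite lee_fin.
  move=> hw; rewrite /rsum !nn1.
  - by case: (leP (h w) 0); case: (leP (- h w) 0); lra.
  - by move=> v; rewrite le_max lexx orbT.
  - by move=> v /hw ->; rewrite oppr0 maxxx.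
  - by move=> v; rewrite le_max lexx orbT.
  - by move=> v /hw ->; rewrite maxxx.
have dE v : ell2_delta w v = if v == w then 1 else 0.
  by rewrite /=; case: eqP.
rewrite /inner/= /ell2_inner !sum1.
- by rewrite dE eqxx; case: (f w) => a b /=; congr (_ +i* _); ring.
- by move=> v /negPf vw; rewrite dE vw; case: (f v) => a b /=; ring.
- by move=> v /negPf vw; rewrite dE vw; case: (f v) => a b /=; ring.
Qed.

End Ell2Hilbert.

Definition weakly_decreasing (s : seq nat) : bool :=
  all (leq 1) s && sorted geq s.

Definition wm_word := {s : seq nat | weakly_decreasing s}.

Definition wm_empty : wm_word := Sub [::] isT.

Definition weakly_monotone_fock (R : realType) := ell2 R wm_word.

Section WeaklyMonotone.
Context {R : realType}.
Local Notation fock := (weakly_monotone_fock R).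
Implicit Types (f g : fock) (s : seq nat) (w : wm_word).

(* The basis vector e_{i_1} (x) ... (x) e_{i_k} of the word [:: i_1; ...; i_k],
   and the vacuum for the empty word.  It is meant for weakly decreasing words
   only ([insubd] returns the empty word on the other ones). *)
Definition fock_basis s : fock := ell2_delta (insubd wm_empty s).

Lemma fock_basis_orthonormal s t :
  weakly_decreasing s -> weakly_decreasing t ->
  inner (fock_basis s) (fock_basis t) = (s == t)%:R.
Proof.
move=> ss st; rewrite inner_delta /=.
by rewrite -val_eqE !insubdK// eq_sym.
Qed.

Lemma fock_basis_total f :
  (forall s, weakly_decreasing s -> inner f (fock_basis s) = 0) -> f = 0.
Proof.
move=> f0; apply: ell2P => w.
rewrite -inner_delta; have := f0 _ (valP w).
by rewrite /fock_basis valKd.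
Qed.

Definition wm_tail w : wm_word := insubd wm_empty (behead (val w)).

Lemma weakly_decreasing_cons i j s : (0 < i)%N ->
  weakly_decreasing [:: i, j & s] = (j <= i)%N && weakly_decreasing (j :: s).
Proof.
by move=> i0; rewrite /weakly_decreasing /= i0 /= andbCA; congr andb.
Qed.

Lemma weakly_decreasing_behead s :
  weakly_decreasing s -> weakly_decreasing (behead s).
Proof.
case: s => // i s /andP[/= /andP[_ h] /path_sorted ds].
by rewrite /weakly_decreasing h.
Qed.

Lemma val_wm_tail w : val (wm_tail w) = behead (val w).
Proof. by rewrite insubdK//; apply: weakly_decreasing_behead; exact: valP. Qed.

(* The coordinate of A_i^+ f along a word v is the coordinate of f along w when
   v is i followed by w, and 0 when v does not begin with i. *)
Definition creator_fun (i : nat) (f : wm_word -> R[i]) (w : wm_word) : R[i] :=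
  if ohead (val w) == Some i then f (wm_tail w) else 0.

Lemma creator_esum_le i (f : wm_word -> R[i]) :
  (\esum_(w in [set: wm_word]) (sqmod (creator_fun i f w))%:E <=
   \esum_(w in [set: wm_word]) (sqmod (f w))%:E)%E.
Proof.
pose P := [set w : wm_word | ohead (val w) == Some i].
have -> : \esum_(w in [set: wm_word]) (sqmod (creator_fun i f w))%:E =
          \esum_(w in P) (sqmod (f (wm_tail w)))%:E.
  rewrite [RHS]esum_mkcond; apply: eq_esum => w _; rewrite /creator_fun.
  have -> : (w \in P) = (ohead (val w) == Some i).
    by apply/idP/idP; rewrite in_setE.
  by case: ifPn; rewrite ?sqmod0.
rewrite -(esum_image P wm_tail (fun w => (sqmod (f w))%:E)).
  rewrite esum_mkcond; apply: le_esum => w _.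
  by case: ifPn => _ //; rewrite lee_fin; exact: sqmod_ge0.
move=> v w; rewrite !in_setE => /= hv hw /(congr1 val).
rewrite !val_wm_tail => vw; apply: val_inj.
case: v w hv hw vw => [[|a s] ?] [[|b t] ?]//=.
by move=> /eqP[->] /eqP[->] ->.
Qed.

Lemma creator_square_summable i f :
  creator_fun i f \in @square_summable R wm_word.
Proof.
have := ell2_summable f; rewrite unfold_in /square_summable /rsummable.
rewrite /summable; apply: le_lt_trans.
have absE (g : wm_word -> R[i]) :
    \esum_(w in [set: wm_word]) `|(sqmod (g w))%:E|%E =
    \esum_(w in [set: wm_word]) (sqmod (g w))%:E.
  by apply: eq_esum => w _; rewrite /= ger0_norm ?sqmod_ge0.
by rewrite !absE creator_esum_le.
Qed.

(* The creator A_i^+ (it is 0 for i = 0, which is not an index). *)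
Definition creator (i : nat) (f : fock) : fock :=
  Ell2 _ (creator_square_summable i f).

Lemma creator_vacuum i : (0 < i)%N ->
  creator i (fock_basis [::]) = fock_basis [:: i].
Proof.
move=> i0; apply: ell2P => w /=; rewrite /creator_fun /= -!val_eqE.
rewrite val_wm_tail !insubdK//; last by rewrite unfold_in /weakly_decreasing/= i0.
case: w => [[|a s] pw] //=; rewrite eqseq_cons (inj_eq Some_inj).
by case: eqP.
Qed.

Lemma creator_basis i j s : (0 < i)%N -> weakly_decreasing (j :: s) ->
  creator i (fock_basis (j :: s)) =
  if (j <= i)%N then fock_basis [:: i, j & s] else 0.
Proof.
move=> i0 js; apply: ell2P => w; rewrite [LHS]/= /creator_fun /= -val_eqE.
rewrite val_wm_tail insubdK//.
have [ji|ij] := leqP j i.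
  have wij : weakly_decreasing [:: i, j & s].
    by rewrite weakly_decreasing_cons ?ji.
  rewrite /= -val_eqE [in RHS]insubdK//.
  case: w => [[|a t] pw] //=; rewrite eqseq_cons (inj_eq Some_inj).
  by case: eqP.
case: ifPn => // wi; case: eqP => // wt; exfalso.
case: w wi wt => [[|a t] pw] //= /eqP[ai] ts; move: pw; rewrite ai ts.
by rewrite weakly_decreasing_cons// leqNgt ij.
Qed.

Lemma creator_linear i : linear (creator i).
Proof.
move=> c f g; apply: ell2P => w; rewrite ell2D ell2Z /= /creator_fun.
by case: ifPn => // _; rewrite mulr0 addr0.
Qed.

Lemma creator_norm_le i f : `|creator i f| <= `|f|.
Proof.
rewrite !ell2_normE lecR ler_wsqrtr// -lee_fin /ell2_sqnorm.
have sE (g : fock) := nnsum_fin (ell2_summable g) (fun w => sqmod_ge0 (g w)).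
by rewrite (sE (creator i f)) (sE f); exact: creator_esum_le.
Qed.

Lemma creator_bounded i : bounded_op (creator i).
Proof.
split; first exact: creator_linear.
pose A : {linear fock -> fock} :=
  HB.pack (creator i) (GRing.isLinear.Build _ _ _ _ _ (creator_linear i)).
apply: (@bounded_linear_continuous _ _ _ A); apply/linear_boundedP.
exists 1; split=> // r r1 f; apply: le_trans (creator_norm_le i f) _.
by rewrite ler_peMl// ltW.
Qed.

(* Creators and annihilators, A_i being the adjoint of A_i^+. *)
Definition wm_generators : set (fock -> fock) :=
  [set T | exists2 i, (0 < i)%N &
    T = creator i \/ adjoint_of (creator i) T].

Definition weakly_monotone_cstar : set (fock -> fock) :=
  cstar_generated wm_generators.

Lemma weakly_monotone_cstarP : cstar_subalgebra weakly_monotone_cstar.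
Proof.
apply: cstar_generatedP => T [i _] [->|]; first exact: creator_bounded.
exact: adjoint_bounded (creator_bounded i).
Qed.

End WeaklyMonotone.

(* Main.v *)
Require Import Defs.
From HB Require Import structures.
From mathcomp Require Import all_boot all_order all_algebra.
From mathcomp Require Import complex.
From mathcomp Require Import boolp classical_sets.
From mathcomp Require Import reals topology normedtype sequences.
From mathcomp Require Import ring lra.

Set Implicit Arguments.
Unset Strict Implicit.
Unset Printing Implicit Defensive.

Import Order.TTheory GRing.Theory Num.Theory.
Import numFieldNormedType.Exports.

Local Open Scope classical_set_scope.
Local Open Scope complex_scope.
Local Open Scope ring_scope.

(** The algebra is filtered by the projections [P_k] onto the words with letters
    at most [k], [P_0] being the vacuum projection.  With [A_i^+] the creators,
    [A_i A_i^+ = P_i] and [A_i^+ A_i = P_i - P_(i-1)]: on the range of [P_i] the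
    operator [A_i^+] is an isometry, and its defect space is the previous level.

    Let [rho] be a nondegenerate representation, [M] the bicommutant of its image
    and [z] a nonzero central projection of [M].  The [P_k] form an approximate
    unit, so there is a least [n] with [z rho(P_n) <> 0]
    ([exists_head_projection]); the claim is that [e = z rho(P_n)] is an abelian
    projection of [M] ([lowest_abelian]).  By minimality the defect of
    [rho(A_n^+)] is invisible under [z], so that [N = rho(A_n^+) e] is normal: it
    is unitary on the range of [e], or zero if [n = 0].  The other generators
    vanish when compressed by [e], and the relations between creators and
    annihilators show that [e rho(T) e] lies in the bicommutant of [e], [N] and
    [N^*], which is commutative, for all [T] in the algebra.

    Two general facts complete the argument.  A star representation is norm
    continuous ([rep_hnorm_le]), so that properties of polynomials in the
    generators pass to the generated algebra; this follows from the square root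
    [1 - sqrt (1 - T^* T)], obtained by a convergent iteration
    ([half_square_root]).  Moreover commutativity of the compressions by [e]
    passes from the image of [rho] to [M] ([bicommutant_compression]); this is
    the density argument of the bicommutant theorem for two vectors
    ([bicommutant_functional]), and it rests on the projection theorem in the
    sum of two copies of the Hilbert space ([projection_theorem], [hsum]). *)

(** * Real-valued norms and explicit limits *)

Section RealNorm.
Context {R : realType} {H : hilbertType R}.
Implicit Types (x y z : H) (a : R[i]).

(** The norm of a Hilbert space takes its values in the partially ordered field
    [R[i]]; estimates are carried out on this real version instead. *)
Definition hnorm x : R := complex.Re `|x|.

Lemma normc_Re a : `|a| = (complex.Re `|a|)%:C.
Proof. by have /complex_realP[k ->] : `|a| \is Num.real by exact: normr_real. Qed.

Lemma hnormE x : `|x| = (hnorm x)%:C.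
Proof.
by rewrite /hnorm; have /complex_realP[k ->] : `|x| \is Num.real by exact: normr_real.
Qed.

Lemma hnorm_ge0 x : 0 <= hnorm x.
Proof. by rewrite -lecR -hnormE normr_ge0. Qed.

Lemma hnormD x y : hnorm (x + y) <= hnorm x + hnorm y.
Proof. by rewrite -lecR rmorphD /= -!hnormE ler_normD. Qed.

Lemma hnormZ a x : hnorm (a *: x) = complex.Re `|a| * hnorm x.
Proof.
by apply: complexI; rewrite rmorphM /= -!hnormE -normc_Re normrZ.
Qed.

Lemma hnormN x : hnorm (- x) = hnorm x.
Proof. by rewrite /hnorm normrN. Qed.

Lemma hdistC x y : hnorm (x - y) = hnorm (y - x).
Proof. by rewrite -hnormN opprB. Qed.

Lemma hdistD y x z : hnorm (x - z) <= hnorm (x - y) + hnorm (y - z).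
Proof. by rewrite -[x in leLHS](subrK y) -addrA hnormD. Qed.

Lemma hnorm0 : hnorm (0 : H) = 0.
Proof. by rewrite /hnorm normr0. Qed.

Lemma hnorm_eq0 x : hnorm x = 0 -> x = 0.
Proof. by move=> x0; apply/normr0_eq0; rewrite hnormE x0. Qed.

Lemma inner_hnorm x : inner x x = (hnorm x ^+ 2)%:C.
Proof. by rewrite inner_norm hnormE rmorphXn. Qed.

Lemma inner_le x y : complex.Re `|inner x y| <= hnorm x * hnorm y.
Proof. by rewrite -lecR rmorphM /= -normc_Re -!hnormE cauchy_schwarz. Qed.

Lemma innerNl x y : inner (- x) y = - inner x y.
Proof. by rewrite -scaleN1r innerZl mulN1r. Qed.

Lemma innerBl x y z : inner (x - y) z = inner x z - inner y z.
Proof. by rewrite innerDl innerNl. Qed.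

Lemma innerNr x y : inner x (- y) = - inner x y.
Proof. by rewrite -scaleN1r innerZr rmorphN /= rmorph1 mulN1r. Qed.

Lemma inner0r x : inner x 0 = 0.
Proof. by rewrite -(subrr x) innerBr subrr. Qed.

Lemma hnormB_sqr x y :
  hnorm (x - y) ^+ 2 = hnorm x ^+ 2 - 2 * complex.Re (inner x y) + hnorm y ^+ 2.
Proof.
have h z : hnorm z ^+ 2 = complex.Re (inner z z) by rewrite inner_hnorm.
rewrite !h innerBl !innerBr (inner_conj x y).
by case: (inner x x) (inner x y) (inner y y) => a b [c d] [f g] /=; lra.
Qed.

Lemma parallelogram x y :
  hnorm (x + y) ^+ 2 + hnorm (x - y) ^+ 2 = 2 * hnorm x ^+ 2 + 2 * hnorm y ^+ 2.
Proof.
rewrite -{1}(opprK y) !hnormB_sqr hnormN innerNr raddfN /=; lra.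
Qed.

Lemma Re_normc_ge0 a : 0 <= complex.Re `|a|.
Proof. by rewrite -lecR -normc_Re normr_ge0. Qed.

Lemma Re_normc_real (k : R) : 0 <= k -> complex.Re `|k%:C| = k.
Proof. by move=> k0; rewrite ger0_norm// lecR. Qed.

Lemma ler0_halves (b c : R) : (forall n, b <= c * 2^-1 ^+ n) -> b <= 0.
Proof.
move=> h; have /cvgr_lt hc : (fun n => c * 2^-1 ^+ n) @ \oo --> (0 : R).
  rewrite -[0 : R](mulr0 c); apply: cvgMr; apply: cvg_expr.
  by rewrite ger0_norm ?invr_ge0// invf_lt1// ltr1n.
rewrite leNgt; apply/negP => b0.
have [n _ /(_ n (leqnn n)) /=] := hc _ b0.
by rewrite ltNge h.
Qed.

(** Every limit below is built from an iteration with geometrically decreasing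
    steps; the explicit error bound replaces later appeals to filters. *)
Lemma geometric_limit (u : nat -> H) (c : R) :
  (forall n, hnorm (u n.+1 - u n) <= c * 2^-1 ^+ n) ->
  exists l, forall n, hnorm (l - u n) <= 2 * c * 2^-1 ^+ n.
Proof.
move=> uc.
have c0 : 0 <= c by have := uc 0%N; rewrite expr0 mulr1; apply: le_trans (hnorm_ge0 _).
have ukn n k : hnorm (u (n + k)%N - u n) <= 2 * c * (2^-1 ^+ n - 2^-1 ^+ (n + k)).
  elim: k => [|k IH]; first by rewrite addn0 !subrr hnorm0 mulr0.
  apply: le_trans (hdistD (u (n + k)%N) _ _) _.
  rewrite addnS; apply: le_trans (lerD (uc _) IH) _.
  by rewrite exprS; lra.
have half0 m : 0 <= 2^-1 ^+ m :> R by rewrite exprn_ge0// invr_ge0.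
have ukn' n k : hnorm (u (n + k)%N - u n) <= 2 * c * 2^-1 ^+ n.
  apply: le_trans (ukn n k) _; rewrite ler_wpM2l ?mulr_ge0//.
  by rewrite lerBlDr lerDl.
have : cvg (u @ \oo).
  apply: cauchy_cvg; apply: cauchy_exP => e e0.
  have [e' eE] : exists e' : R, e = e'%:C.
    by apply/complex_realP; exact: gtr0_real.
  move: e0; rewrite eE ltcR => e0.
  have [n ne] : exists n, 2 * c * 2^-1 ^+ n < e'.
    apply: contrapT => /forallNP hn.
    have := @ler0_halves e' (2 * c); rewrite leNgt e0 /= => /(_ _)/negP[] //.
    by move=> n; rewrite leNgt; apply/negP; exact: hn.
  exists (u n); exists n => // m /= nm.
  rewrite -ball_normE /ball_ /= hnormE ltcR hdistC -(subnKC nm).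
  exact: le_lt_trans (ukn' _ _) ne.
move=> /cvg_ex[l ul]; exists l => n.
rewrite -subr_le0; apply: (@ler0_halves _ 1) => k; rewrite mul1r.
have k0 : 0 < 2^-1 ^+ k :> R by rewrite exprn_gt0// invr_gt0.
have kC0 : 0 < (2^-1 ^+ k)%:C :> R[i] by rewrite ltcR.
have /cvgrPdist_lt/(_ _ kC0)[m _ /(_ (n + m)%N (leq_addl _ _))/=] := ul.
rewrite hnormE ltcR => /ltW h.
rewrite lerBlDr; apply: le_trans (hdistD (u (n + m)%N) _ _) _.
by rewrite lerD.
Qed.

End RealNorm.

(** * Projection theorem and adjoints *)

Section Projections.
Context {R : realType} {H : hilbertType R}.
Implicit Types (x y : H) (T S : H -> H).

Lemma bounded_opD T x y : bounded_op T -> T (x + y) = T x + T y.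
Proof. by case=> Tl _; rewrite -{1}[x]scale1r Tl scale1r. Qed.

Lemma bounded_op0 T : bounded_op T -> T 0 = 0.
Proof. by move=> Tb; apply: (addrI (T 0)); rewrite -bounded_opD// !addr0. Qed.

Lemma bounded_opZ T a x : bounded_op T -> T (a *: x) = a *: T x.
Proof.
by move=> Tb; case: (Tb) => Tl _; rewrite -[a *: x]addr0 Tl bounded_op0// !addr0.
Qed.

Lemma bounded_opB T x y : bounded_op T -> T (x - y) = T x - T y.
Proof.
by move=> Tb; rewrite bounded_opD// -scaleN1r bounded_opZ// scaleN1r.
Qed.

Lemma bounded_op_hnorm T : bounded_op T ->
  exists2 c : R, 0 < c & forall x, hnorm (T x) <= c * hnorm x.
Proof.
move=> /bounded_op_bound[c c0 Tc]; exists c => // x.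
by rewrite -lecR rmorphM /= -!hnormE.
Qed.

Lemma hnorm_bounded_op T (c : R) : linear T ->
  (forall x, hnorm (T x) <= c * hnorm x) -> bounded_op T.
Proof.
move=> Tl Tc; apply: bounded_opP => //; exists c => x.
by rewrite !hnormE -rmorphM lecR.
Qed.

Definition subspace (K : set H) : Prop :=
  K 0 /\ forall a x y, K x -> K y -> K (a *: x + y).

Lemma Re_normc_sqr (a : R[i]) : complex.Re `|a| ^+ 2 = sqmod a.
Proof. by rewrite normc_sqmod /= sqr_sqrtr// sqmod_ge0. Qed.

Lemma sqr_le_halves (b c : R) n : 0 <= c -> b ^+ 2 <= c ^+ 2 * 4^-1 ^+ n ->
  b <= c * 2^-1 ^+ n.
Proof.
move=> c0 bc; have h0 : 0 <= 2^-1 ^+ n :> R by rewrite exprn_ge0// invr_ge0.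
have [b0|/ltW b0] := leP 0 b; last by rewrite (le_trans b0)// mulr_ge0.
rewrite -ler_sqr ?nnegrE ?mulr_ge0// exprMn.
have -> : (2^-1 ^+ n) ^+ 2 = 4^-1 ^+ n :> R; last by [].
by rewrite -exprM mulnC exprM; congr (_ ^+ n); field.
Qed.

(** A minimizing sequence for the distance from [y] to [K] converges, because
    the parallelogram identity bounds its steps; near-minimality also makes
    [y - k_n] almost orthogonal to each vector of [K]. *)
Lemma projection_theorem (K : set H) y : subspace K ->
  exists q, (forall eps : R, 0 < eps -> exists2 k, K k & hnorm (q - k) <= eps) /\
    forall k, K k -> inner (y - q) k = 0.
Proof.
move=> [K0 Klin].
have KD u v : K u -> K v -> K (u + v).
  by move=> Ku Kv; rewrite -[u]scale1r; exact: Klin.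
have KZ a u : K u -> K (a *: u).
  by move=> Ku; rewrite -[_ *: _]addr0; exact: Klin.
pose D := [set hnorm (y - k) ^+ 2 | k in K].
have Dinf : has_inf D.
  split; first by exists (hnorm (y - 0) ^+ 2), 0.
  by exists 0 => _ [k _ <-]; rewrite sqr_ge0.
pose d := inf D.
have dK k : K k -> d <= hnorm (y - k) ^+ 2.
  by move=> Kk; apply: ge_inf; [case: Dinf|exists k].
have q0 n : 0 < 4^-1 ^+ n :> R by rewrite exprn_gt0// invr_gt0.
have /choice[u uP] n : exists k, K k /\ hnorm (y - k) ^+ 2 <= d + 4^-1 ^+ n.
  by have [_ [k Kk <-] /ltW kd] := inf_adherent (q0 n) Dinf; exists k.
have uK n : K (u n) by case: (uP n).
have ud n : hnorm (y - u n) ^+ 2 <= d + 4^-1 ^+ n by case: (uP n).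
have ustep n : hnorm (u n.+1 - u n) <= 2 * 2^-1 ^+ n.
  apply: sqr_le_halves => //.
  have := parallelogram (y - u n) (y - u n.+1).
  rewrite (_ : y - u n - (y - u n.+1) = u n.+1 - u n); last first.
    by rewrite opprB addrC addrA subrK.
  have := dK _ (KZ 2^-1 _ (KD _ _ (uK n) (uK n.+1))).
  have -> : y - u n + (y - u n.+1) = 2 *: (y - 2^-1 *: (u n + u n.+1)).
    rewrite scalerBr scalerA divff ?pnatr_eq0// scale1r scaler_nat mulr2n.
    by rewrite opprD addrACA.
  rewrite hnormZ (_ : complex.Re `|2| = 2) ?exprMn; last first.
    by rewrite (_ : 2 = 2%:C) ?Re_normc_real// rmorph_nat.
  by have := ud n; have := ud n.+1; have := q0 n; rewrite [4^-1 ^+ n.+1]exprS; lra.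
have [q qu] := geometric_limit ustep.
have uorth n k : K k ->
    complex.Re `|inner (y - u n) k| <= hnorm k * 2^-1 ^+ n.
  move=> Kk; apply: sqr_le_halves; first exact: hnorm_ge0.
  have [k0|k0] := eqVneq (hnorm k) 0.
    by rewrite (hnorm_eq0 k0) inner0r normr0 hnorm0 /= expr0n mul0r.
  have n0 : 0 < hnorm k ^+ 2 by rewrite exprn_gt0// lt_neqAle eq_sym k0 hnorm_ge0.
  rewrite Re_normc_sqr; set al := inner _ _.
  (* the best multiple of [k] to subtract *)
  pose t := ((hnorm k ^+ 2)^-1)%:C * al.
  have /dK : K (u n + t *: k) by apply: KD => //; exact: KZ.
  rewrite opprD addrA hnormB_sqr hnormZ exprMn innerZr -/al Re_normc_sqr.
  have -> : complex.Re (t^* * al) = sqmod al / hnorm k ^+ 2.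
    by rewrite /t /sqmod; case: (al) => a b /=; ring.
  have -> : sqmod t * hnorm k ^+ 2 = sqmod al / hnorm k ^+ 2.
    by rewrite /t /sqmod; case: (al) => a b /=; field.
  move=> h; rewrite mulrC -ler_pdivrMr//; have := ud n; lra.
exists q; split=> [eps e0|k Kk].
  apply: contrapT => hn; have := @ler0_halves _ eps (2 * 2).
  rewrite leNgt e0 /= => /(_ _)/negP[]// n.
  apply: le_trans (qu n); rewrite leNgt; apply/negP => /ltW h.
  by apply: hn; exists (u n).
apply/normr0_eq0; rewrite normc_Re; congr (_%:C); apply/eqP.
rewrite eq_le Re_normc_ge0 andbT.
apply: (@ler0_halves _ _ (5 * hnorm k)) => n.
have := uorth n _ Kk.
have : complex.Re `|inner (q - u n) k| <= 2 * 2 * 2^-1 ^+ n * hnorm k.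
  by apply: le_trans (inner_le _ _) _; rewrite ler_wpM2r ?hnorm_ge0.
suff : complex.Re `|inner (y - q) k| <= complex.Re `|inner (y - u n) k| +
   complex.Re `|inner (q - u n) k| by lra.
rewrite -lecR rmorphD /= -!normc_Re.
have -> : inner (y - q) k = inner (y - u n) k - inner (q - u n) k.
  by rewrite -innerBl opprB addrA subrK.
exact: ler_normB.
Qed.

(** The representing vector is a multiple of the component of some [y0], with
    [f y0 <> 0], that is orthogonal to the kernel of [f]. *)
Lemma riesz_representation (f : H -> R[i]) (c : R) :
  (forall a x y, f (a *: x + y) = a * f x + f y) ->
  (forall x, complex.Re `|f x| <= c * hnorm x) ->
  exists y, forall x, f x = inner x y.
Proof.
move=> flin fc; have f0 : f 0 = 0.
  by apply: (addrI (f 0)); rewrite -{1}[f 0]mul1r -flin !addr0 scale1r.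
have fB x y : f (x - y) = f x - f y.
  by rewrite addrC -scaleN1r flin mulN1r addrC.
have [fz|/existsNP[y0 y0P]] := pselect (forall x, f x = 0).
  by exists 0 => x; rewrite fz inner0r.
have c0 : 0 <= c.
  have n0 : 0 < hnorm y0.
    rewrite lt_neqAle hnorm_ge0 andbT; apply/negP => /eqP/esym/hnorm_eq0 y00.
    by apply: y0P; rewrite y00.
  by rewrite -(pmulr_lge0 _ n0) (le_trans _ (fc y0))// Re_normc_ge0.
have Ksub : subspace [set x | f x = 0].
  by split=> //= a x y fx fy; rewrite flin fx fy mulr0 addr0.
have [q [qK qorth]] := projection_theorem y0 Ksub.
have fq : f q = 0.
  apply/normr0_eq0; rewrite normc_Re; congr (_%:C); apply/eqP.
  rewrite eq_le Re_normc_ge0 andbT.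
  apply: (@ler0_halves _ _ c) => n.
  have e0 : 0 < 2^-1 ^+ n :> R by rewrite exprn_gt0// invr_gt0.
  have [k /= fk qk] := qK _ e0.
  rewrite -[f q]subr0 -fk -fB; apply: le_trans (fc _) _.
  by rewrite ler_wpM2l.
pose w := y0 - q.
have fw : f w != 0 by rewrite /w fB fq subr0; apply/eqP.
have w0 : inner w w != 0.
  rewrite inner_norm sqrf_eq0 normr_eq0; apply: contraNN fw => /eqP ->.
  by rewrite f0.
exists ((f w / inner w w)^* *: w) => x.
rewrite innerZr conjCK.
have : inner (x - (f x / f w) *: w) w = 0.
  rewrite inner_conj qorth ?rmorph0//=.
  by rewrite addrC -scaleNr flin mulNr divfK// addNr.
rewrite innerBl innerZl => /subr0_eq ->.
by field; rewrite fw w0.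
Qed.

Lemma adjoint_exists T : bounded_op T -> exists S, adjoint_of T S.
Proof.
move=> Tb; have [c c0 Tc] := bounded_op_hnorm Tb.
have /choice[S SP] y : exists z, forall x, inner (T x) y = inner x z.
  apply: (@riesz_representation _ (c * hnorm y)) => [a x z|x].
    by case: Tb => Tl _; rewrite Tl inner_linearl.
  apply: le_trans (inner_le _ _) _.
  by rewrite mulrAC ler_wpM2r ?hnorm_ge0.
by exists S.
Qed.

Lemma adjoint_sym T S : adjoint_of T S -> adjoint_of S T.
Proof. by move=> TS x y; rewrite inner_conj -TS -inner_conj. Qed.

Lemma adjoint_unique T S S' : adjoint_of T S -> adjoint_of T S' -> S = S'.
Proof.
by move=> TS TS'; apply/funext => y; apply: inner_eq => x; rewrite -TS TS'.
Qed.

Lemma adjoint_comp T S T' S' : adjoint_of T S -> adjoint_of T' S' ->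
  adjoint_of (T \o T') (S' \o S).
Proof. by move=> TS TS' x y; rewrite /= TS TS'. Qed.

Lemma adjoint_lin (a : R[i]) T S T' S' : adjoint_of T S -> adjoint_of T' S' ->
  adjoint_of (fun x => a *: T x + T' x) (fun x => a^* *: S x + S' x).
Proof.
by move=> TS TS' x y; rewrite innerDl innerZl innerDr innerZr TS TS' conjCK.
Qed.

Lemma adjoint_hnorm T S (c : R) : adjoint_of T S ->
  (forall x, hnorm (T x) <= c * hnorm x) -> forall y, hnorm (S y) <= c * hnorm y.
Proof.
move=> TS Tc y; have [Sy0|Sy0] := eqVneq (S y) 0.
  by rewrite Sy0 hnorm0; exact: le_trans (hnorm_ge0 _) (Tc y).
have n0 : 0 < hnorm (S y).
  rewrite lt_neqAle hnorm_ge0 andbT eq_sym; apply: contraNN Sy0 => /eqP h.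
  by rewrite (hnorm_eq0 h).
rewrite -(ler_pM2l n0) -expr2.
have -> : hnorm (S y) ^+ 2 = complex.Re `|inner (T (S y)) y|.
  by rewrite TS inner_hnorm Re_normc_real// sqr_ge0.
apply: le_trans (inner_le _ _) _.
by rewrite mulrA ler_wpM2r ?hnorm_ge0// mulrC Tc.
Qed.

End Projections.

(** * The orthogonal sum of two copies of a Hilbert space *)

(** An alias, because the product type already carries the supremum norm, which
    does not come from an inner product. *)
Definition hsum (R : realType) (H : hilbertType R) : Type := (H * H)%type.

Section HilbertSum.
Context {R : realType} {H : hilbertType R}.

HB.instance Definition _ := GRing.Lmodule.copy (hsum H) (H * H)%type.

Implicit Types p q : hsum H.

Lemma hsumP p q : p.1 = q.1 -> p.2 = q.2 -> p = q.
Proof. by case: p q => p1 p2 [q1 q2] /= -> ->. Qed.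

Definition hsum_rnorm p : R := Num.sqrt (hnorm p.1 ^+ 2 + hnorm p.2 ^+ 2).

Definition hsum_norm p : R[i] := (hsum_rnorm p)%:C.

Lemma hsum_rnorm_sqr p : hsum_rnorm p ^+ 2 = hnorm p.1 ^+ 2 + hnorm p.2 ^+ 2.
Proof. by rewrite sqr_sqrtr// addr_ge0 ?sqr_ge0. Qed.

Lemma hsum_rnorm_ge0 p : 0 <= hsum_rnorm p.
Proof. exact: sqrtr_ge0. Qed.

Lemma hnorm_fst_le p : hnorm p.1 <= hsum_rnorm p.
Proof.
by rewrite -ler_sqr ?nnegrE ?hnorm_ge0 ?hsum_rnorm_ge0// hsum_rnorm_sqr lerDl sqr_ge0.
Qed.

Lemma hnorm_snd_le p : hnorm p.2 <= hsum_rnorm p.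
Proof.
by rewrite -ler_sqr ?nnegrE ?hnorm_ge0 ?hsum_rnorm_ge0// hsum_rnorm_sqr lerDr sqr_ge0.
Qed.

Lemma hsum_rnorm_le p : hsum_rnorm p <= hnorm p.1 + hnorm p.2.
Proof.
rewrite -ler_sqr ?nnegrE ?hsum_rnorm_ge0 ?addr_ge0 ?hnorm_ge0// hsum_rnorm_sqr.
have := hnorm_ge0 p.1; have := hnorm_ge0 p.2; nra.
Qed.

Lemma hsum_norm_triangle p q : hsum_norm (p + q) <= hsum_norm p + hsum_norm q.
Proof.
rewrite -rmorphD lecR -ler_sqr ?nnegrE ?addr_ge0 ?hsum_rnorm_ge0//.
rewrite sqrrD !hsum_rnorm_sqr /=.
have cs : hnorm p.1 * hnorm q.1 + hnorm p.2 * hnorm q.2 <=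
    hsum_rnorm p * hsum_rnorm q.
  rewrite -ler_sqr ?nnegrE ?mulr_ge0 ?addr_ge0 ?mulr_ge0 ?hnorm_ge0 ?hsum_rnorm_ge0//.
  rewrite exprMn !hsum_rnorm_sqr.
  have := sqr_ge0 (hnorm p.1 * hnorm q.2 - hnorm p.2 * hnorm q.1); lra.
have := hnormD p.1 q.1; have := hnormD p.2 q.2.
have := hnorm_ge0 (p.1 + q.1); have := hnorm_ge0 (p.2 + q.2).
have sq (a b : R) : 0 <= a -> a <= b -> a ^+ 2 <= b ^+ 2 by move=> *; nra.
move=> h2 h1 /(sq _ _ h2) k2 /(sq _ _ h1) k1.
by move: k1 k2; rewrite !sqrrD; lra.
Qed.

Lemma hsum_normZ (a : R[i]) p : hsum_norm (a *: p) = `|a| * hsum_norm p.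
Proof.
rewrite normc_Re -rmorphM; congr (_%:C).
rewrite /hsum_rnorm /= !hnormZ !exprMn -mulrDr sqrtrM ?sqr_ge0//.
by rewrite sqrtr_sqr ger0_norm// Re_normc_ge0.
Qed.

Lemma hsum_norm_eq0 p : hsum_norm p = 0 -> p = 0.
Proof.
move=> /complexI p0; apply: hsumP; apply/hnorm_eq0/eqP; rewrite eq_le hnorm_ge0 andbT.
  by rewrite -p0 hnorm_fst_le.
by rewrite -p0 hnorm_snd_le.
Qed.

HB.instance Definition _ := Lmodule_isNormed.Build R[i] (hsum H)
  hsum_norm_triangle hsum_normZ hsum_norm_eq0.

Lemma hsum_normE p : `|p| = (hsum_rnorm p)%:C.
Proof. by []. Qed.

Lemma hsum_complete (F : set_system (hsum H)) :
  ProperFilter F -> cauchy F -> cvg F.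
Proof.
move=> FF FC.
have Fcvg (phi : hsum H -> H) :
    (forall p q, hnorm (phi p - phi q) <= hsum_rnorm (p - q)) ->
    cvg (phi @ F).
  move=> phiP; apply: cauchy_cvg; apply: cauchy_exP => e e0.
  have [x Fx] := (cauchyP F).1 FC _ e0.
  exists (phi x); apply: (@filterS _ F _ _ _ _ Fx) => y.
  rewrite /= -!ball_normE /ball_/= hnormE.
  by rewrite hsum_normE; apply: le_lt_trans; rewrite lecR phiP.
have /cvg_ex[l1 c1] : cvg ((fun p : hsum H => p.1) @ F).
  by apply: Fcvg => p q; exact: (hnorm_fst_le (p - q)).
have /cvg_ex[l2 c2] : cvg ((fun p : hsum H => p.2) @ F).
  by apply: Fcvg => p q; exact: (hnorm_snd_le (p - q)).
apply/cvg_ex; exists ((l1, l2) : hsum H); apply/cvgrPdist_lt => eps eps0.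
have e20 : 0 < eps / 2 by rewrite divr_gt0.
have /cvgrPdist_lt/(_ _ e20) n1 := c1.
have /cvgrPdist_lt/(_ _ e20) n2 := c2.
apply: filterS2 n1 n2 => p p1 p2.
rewrite hsum_normE; apply: (@le_lt_trans _ _ (`|l1 - p.1| + `|l2 - p.2|)).
  by rewrite !hnormE -rmorphD lecR; exact: (hsum_rnorm_le ((l1, l2) - p)).
by rewrite [eps]splitr ltrD.
Qed.

HB.instance Definition _ := Uniform_isComplete.Build (hsum H) hsum_complete.

Definition hsum_inner p q : R[i] := inner p.1 q.1 + inner p.2 q.2.

Lemma hsum_inner_linearl (a : R[i]) p q r :
  hsum_inner (a *: p + q) r = a * hsum_inner p r + hsum_inner q r.
Proof. by rewrite /hsum_inner /= !inner_linearl mulrDr addrACA. Qed.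

Lemma hsum_inner_conj p q : hsum_inner q p = (hsum_inner p q)^*.
Proof. by rewrite /hsum_inner rmorphD /= -!inner_conj. Qed.

Lemma hsum_inner_norm p : hsum_inner p p = `|p| ^+ 2.
Proof.
by rewrite hsum_normE -rmorphXn hsum_rnorm_sqr rmorphD /hsum_inner !inner_hnorm.
Qed.

HB.instance Definition _ := CompleteNormedModule_isHilbert.Build R (hsum H)
  hsum_inner_linearl hsum_inner_conj hsum_inner_norm.

End HilbertSum.

(** * Orthogonal projections and the bicommutant *)

Section OrthogonalProjection.
Context {R : realType} {H : hilbertType R}.
Implicit Types (x y q : H) (K : set H).

Definition norm_closure K : set H :=
  [set q | forall eps : R, 0 < eps -> exists2 k, K k & hnorm (q - k) <= eps].

Lemma sub_norm_closure K : K `<=` norm_closure K.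
Proof.
by move=> k Kk eps e0; exists k => //; rewrite subrr hnorm0 ltW.
Qed.

Lemma Re_normc_eq0 (a : R[i]) : complex.Re `|a| <= 0 -> a = 0.
Proof.
move=> h; apply/normr0_eq0; rewrite normc_Re; congr (_%:C); apply/eqP.
by rewrite eq_le h Re_normc_ge0.
Qed.

Lemma le_small (b c : R) : 0 <= c ->
  (forall eps, 0 < eps -> b <= c * eps) -> b <= 0.
Proof.
move=> c0 h; apply: (@ler0_halves _ _ c) => n; apply: h.
by rewrite exprn_gt0// invr_gt0.
Qed.

Lemma norm_closure_orthogonal K x q :
  (forall k, K k -> inner x k = 0) -> norm_closure K q -> inner x q = 0.
Proof.
move=> xK Kq; apply: Re_normc_eq0; apply: (le_small (hnorm_ge0 x)) => eps e0.
have [k Kk qk] := Kq _ e0.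
rewrite -[inner x q]subr0 -(xK _ Kk) -innerBr.
by apply: le_trans (inner_le _ _) _; rewrite ler_wpM2l ?hnorm_ge0.
Qed.

Lemma norm_closure_subspace K : subspace K -> subspace (norm_closure K).
Proof.
move=> [K0 Klin]; split; first exact: sub_norm_closure.
move=> a x y Kx Ky eps e0.
have c0 : 0 < complex.Re `|a| + 1 by rewrite ltr_wpDl// Re_normc_ge0.
have [k Kk xk] := Kx _ (divr_gt0 e0 c0); have [l Kl yl] := Ky _ (divr_gt0 e0 c0).
exists (a *: k + l); first exact: Klin.
rewrite opprD addrACA -scalerBr; apply: le_trans (hnormD _ _) _.
rewrite hnormZ; apply: (@le_trans _ _ ((complex.Re `|a| + 1) * (eps / (complex.Re `|a| + 1)))).
  by rewrite mulrDl mul1r lerD// ler_wpM2l ?Re_normc_ge0.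
by rewrite mulrC divfK// gt_eqF.
Qed.

Lemma projection_unique K y q q' : subspace K ->
  norm_closure K q -> (forall k, K k -> inner (y - q) k = 0) ->
  norm_closure K q' -> (forall k, K k -> inner (y - q') k = 0) -> q = q'.
Proof.
move=> Ksub Kq qo Kq' qo'; apply/subr0_eq/hnorm_eq0/eqP.
rewrite -sqrf_eq0; apply/eqP/complexI; rewrite -inner_hnorm.
apply: (norm_closure_orthogonal (K := K)); last first.
  have [_ cl] := norm_closure_subspace Ksub.
  by rewrite addrC -scaleN1r; exact: cl.
move=> k Kk.
have -> : q - q' = (y - q') - (y - q) by rewrite opprB [RHS]addrC addrA subrK.
by rewrite innerBl qo// qo'// subrr.
Qed.

Lemma orthogonal_projection K : subspace K ->
  exists P, [/\ projection P, forall x, norm_closure K (P x) &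
    forall x k, K k -> inner (x - P x) k = 0].
Proof.
move=> Ksub.
have /choice[P PP] x := projection_theorem x Ksub.
have PK x : norm_closure K (P x) by have [] := PP x.
have Po x k : K k -> inner (x - P x) k = 0 by have [_] := PP x; apply.
have [_ cl] := norm_closure_subspace Ksub.
have Poc x q : norm_closure K q -> inner (x - P x) q = 0.
  by apply: norm_closure_orthogonal; exact: Po.
have PE x y : inner (P x) (P y) = inner x (P y).
  by apply/esym/subr0_eq; rewrite -innerBl Poc.
exists P; split=> //; split.
- apply: (@hnorm_bounded_op _ _ _ 1) => [a x y|x].
    apply: (@projection_unique K (a *: x + y)) => //; [exact: Po|exact: cl|].
    move=> k Kk; rewrite opprD addrACA -scalerBr.
    by rewrite inner_linearl !Po// mulr0 addr0.
  rewrite mul1r; have [->|n0] := eqVneq (hnorm (P x)) 0; first exact: hnorm_ge0.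
  have np : 0 < hnorm (P x) by rewrite lt_neqAle eq_sym n0 hnorm_ge0.
  rewrite -(ler_pM2r np) -expr2.
  have -> : hnorm (P x) ^+ 2 = complex.Re `|inner x (P x)|.
    by rewrite -PE inner_hnorm Re_normc_real// sqr_ge0.
  exact: inner_le.
- apply/funext => x /=; apply: (@projection_unique K (P x)) => //; first exact: Po.
  by move=> k Kk; rewrite subrr inner0l.
- move=> x y; rewrite -PE; apply/esym/subr0_eq.
  by rewrite inner_conj [X in _ - X]inner_conj -rmorphB /= PE subrr conjC0.
Qed.

End OrthogonalProjection.

Section DoubleCommutant.
Context {R : realType} {H : hilbertType R}.
Implicit Types (x y : H) (T S a b e : H -> H) (B : set (H -> H)).

Definition adjoint_closed B : Prop :=
  forall a, B a -> exists2 b, B b & adjoint_of a b.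

(** What the bicommutant theorem uses of the image of a nondegenerate
    representation. *)
Record nondegenerate_star_algebra B : Prop := {
  nsa_bounded : B `<=` bounded_op;
  nsa_zero : B (fun=> 0);
  nsa_linear : forall (c : R[i]) a b, B a -> B b -> B (fun x => c *: a x + b x);
  nsa_mul : forall a b, B a -> B b -> B (a \o b);
  nsa_adjoint : adjoint_closed B;
  nsa_nondegenerate : forall x, (forall a, B a -> a x = 0) -> x = 0
}.

Definition amplification a (p : hsum H) : hsum H := (a p.1, a p.2).

(** An equation between two vector functionals extends from [B] to its
    bicommutant.  This is the density argument of the bicommutant theorem on
    [H + H]: the orthogonal projection onto the closure of
    [{(a u1, a u2) | a in B}] has matrix entries in the commutant of [B], so it
    also commutes with the amplification of [T]. *)
Lemma bicommutant_functional B T u1 u2 v1 v2 :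
  nondegenerate_star_algebra B -> commutant (commutant B) T ->
  (forall a, B a -> inner (a u1) v1 = inner (a u2) v2) ->
  inner (T u1) v1 = inner (T u2) v2.
Proof.
move=> BB BT uv; have [Tb Tc] := BT.
pose u : hsum H := (u1, u2); pose v : hsum H := (v1, - v2).
pose K := [set amplification a u | a in B].
have Ksub : subspace K.
  split; first by exists (fun=> 0) => //; exact: nsa_zero.
  move=> c _ _ [a Ba <-] [b Bb <-]; exists (fun x => c *: a x + b x) => //.
  exact: nsa_linear.
have [P [[Pb Pid Psa] PK Po]] := orthogonal_projection Ksub.
have Pfix q : norm_closure K q -> P q = q.
  move=> Kq; apply: (@projection_unique _ _ K q) => //; first exact: Po.
  by move=> k _; rewrite subrr inner0l.
have ampb a : bounded_op a -> bounded_op (amplification a).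
  move=> ab; have [c c0 ac] := bounded_op_hnorm ab.
  apply: (@hnorm_bounded_op _ _ _ c) => [d p q|p].
    by apply: hsumP; rewrite /= bounded_opD// bounded_opZ.
  rewrite -[hnorm _]/(hsum_rnorm _) -[hnorm p]/(hsum_rnorm _).
  rewrite -ler_sqr ?nnegrE ?mulr_ge0 ?hsum_rnorm_ge0 ?(ltW c0)//.
  rewrite exprMn !hsum_rnorm_sqr mulrDr -!exprMn.
  by apply: lerD; rewrite ler_sqr ?nnegrE ?mulr_ge0 ?hnorm_ge0 ?(ltW c0)// ac.
have Bamp a : B a -> bounded_op (amplification a).
  by move=> /(nsa_bounded BB); exact: ampb.
have ampK a q : B a -> norm_closure K q -> norm_closure K (amplification a q).
  move=> Ba Kq eps e0.
  have [c c0 ac] := bounded_op_hnorm (Bamp _ Ba).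
  have [_ [b Bb <-] qb] := Kq _ (divr_gt0 e0 c0).
  exists (amplification (a \o b) u); first by exists (a \o b) => //; exact: nsa_mul.
  have -> : amplification (a \o b) u = amplification a (amplification b u) by [].
  rewrite -bounded_opB; last exact: Bamp.
  apply: le_trans (ac _) _; rewrite -ler_pdivlMl// mulrC; exact: qb.
have PampP a p : B a -> P (amplification a (P p)) = amplification a (P p).
  by move=> Ba; apply: Pfix; exact: ampK.
have Pamp a p : B a -> P (amplification a p) = amplification a (P p).
  move=> Ba; have [b Bb ab] := nsa_adjoint BB Ba.
  have Aab : adjoint_of (amplification a) (amplification b).
    by move=> p1 p2; rewrite /inner /= /hsum_inner /= !ab.
  rewrite -PampP//; apply: inner_eq => r.
  by rewrite -!Psa -!(adjoint_sym Aab) -!Psa PampP.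
have Pu : P u = u.
  apply/esym/subr0_eq; set w := u - P u.
  have aw a : B a -> amplification a w = 0.
    move=> Ba; rewrite bounded_opB; last exact: Bamp.
    by rewrite -Pamp// Pfix ?subrr//; apply: sub_norm_closure; exists a.
  apply: hsumP; apply: (nsa_nondegenerate BB) => a /aw.
    by move=> /(congr1 fst).
  by move=> /(congr1 snd).
have Pv : P v = 0.
  apply: (@projection_unique _ _ K v) => //; first exact: Po.
    by apply: sub_norm_closure; case: Ksub.
  move=> _ [a Ba <-]; rewrite subr0 inner_conj.
  by rewrite /inner /= /hsum_inner /= innerNr uv// subrr conjC0.
(* [f] and [i] stand for the two coordinate maps and the two inclusions, so
   that [f \o P \o i] runs through the matrix entries of [P] *)
have comm1 (f : hsum H -> H) (i : H -> hsum H) :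
    (forall c p q, f (c *: p + q) = c *: f p + f q) ->
    (forall p, hnorm (f p) <= hnorm p) ->
    (forall c x y, i (c *: x + y) = c *: i x + i y) ->
    (forall x, hnorm (i x) <= hnorm x) ->
    (forall a p, B a -> f (amplification a p) = a (f p)) ->
    (forall a x, B a -> i (a x) = amplification a (i x)) ->
    forall x, T (f (P (i x))) = f (P (i (T x))).
  move=> fl fb il ib fa ia x.
  have Q : commutant B (f \o P \o i).
    split; last first.
      by move=> a Ba; apply/funext => y /=; rewrite ia// Pamp// fa.
    have [c c0 Pc] := bounded_op_hnorm Pb.
    apply: (@hnorm_bounded_op _ _ _ c) => [d y z|y] /=.
      by rewrite il bounded_opD// bounded_opZ// fl.
    apply: le_trans (fb _) _; apply: le_trans (Pc _) _.
    by rewrite ler_wpM2l// ltW.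
  by have /(congr1 (fun g => g x)) := Tc _ Q.
have fstb (p : hsum H) : hnorm p.1 <= hnorm p by exact: hnorm_fst_le.
have sndb (p : hsum H) : hnorm p.2 <= hnorm p by exact: hnorm_snd_le.
pose i1 x : hsum H := (x, 0); pose i2 x : hsum H := (0, x).
have i1b x : hnorm (i1 x) <= hnorm x.
  by apply: le_trans (hsum_rnorm_le _) _; rewrite /= hnorm0 addr0.
have i2b x : hnorm (i2 x) <= hnorm x.
  by apply: le_trans (hsum_rnorm_le _) _; rewrite /= hnorm0 add0r.
have i1l (c : R[i]) x y : i1 (c *: x + y) = c *: i1 x + i1 y.
  by apply: hsumP; rewrite //= scaler0 addr0.
have i2l (c : R[i]) x y : i2 (c *: x + y) = c *: i2 x + i2 y.
  by apply: hsumP; rewrite //= scaler0 addr0.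
have i1a a x : B a -> i1 (a x) = amplification a (i1 x).
  by move=> Ba; apply: hsumP => //=; rewrite bounded_op0//; exact: nsa_bounded BB _ Ba.
have i2a a x : B a -> i2 (a x) = amplification a (i2 x).
  by move=> Ba; apply: hsumP => //=; rewrite bounded_op0//; exact: nsa_bounded BB _ Ba.
have PT p : P (amplification T p) = amplification T (P p).
  have Psplit q : P q = P (i1 q.1) + P (i2 q.2).
    by rewrite -bounded_opD//; congr P; apply: hsumP; rewrite /= ?addr0 ?add0r.
  rewrite (Psplit (amplification T p)) (Psplit p) bounded_opD; last exact: ampb.
  by apply: hsumP; congr (_ + _); apply/esym; first [exact: (comm1 fst)|exact: (comm1 snd)].
have : inner (amplification T u) v = 0.
  by rewrite -{1}Pu -PT Psa Pv inner0r.
by rewrite /inner /= /hsum_inner /= innerNr => /subr0_eq.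
Qed.

End DoubleCommutant.

Section Compression.
Context {R : realType} {H : hilbertType R}.
Implicit Types (x y : H) (T S a b e : H -> H) (B : set (H -> H)).

(** The compression of [B''] by [e] is commutative as soon as that of [B] is:
    one factor at a time is moved from [B] to [B'']. *)
Lemma bicommutant_compression B e :
  nondegenerate_star_algebra B -> projection e ->
  (forall a b, B a -> B b ->
    forall x, e (a (e (b (e x)))) = e (b (e (a (e x))))) ->
  forall S T, commutant (commutant B) S -> commutant (commutant B) T ->
    forall x, e (S (e (T (e x)))) = e (T (e (S (e x)))).
Proof.
move=> BB [eb eid esa].
have extend T : bounded_op T ->
    (forall a x, B a -> e (a (e (T (e x)))) = e (T (e (a (e x))))) ->
    forall S x, commutant (commutant B) S ->
      e (S (e (T (e x)))) = e (T (e (S (e x)))).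
  move=> Tb aT S x BS; apply: inner_eq => y; rewrite inner_conj [RHS]inner_conj.
  congr (_^*); have [T' TT'] := adjoint_exists Tb.
  rewrite !esa !TT' !esa; apply: (bicommutant_functional BB BS) => a Ba.
  by rewrite -esa aT// esa TT' esa.
move=> aB S T BS BT; have [Tb _] := BT.
move=> x; apply: (extend T Tb _ S x BS) => a y Ba.
apply/esym; apply: (extend a (nsa_bounded BB Ba) _ T y BT).
by move=> b z Bb; exact: (aB b a Bb Ba z).
Qed.

End Compression.

(** * Continuity of star representations *)

Section Contractivity.
Context {R : realType} {F H : hilbertType R}.
Variables (A : set (F -> F)) (rho : (F -> F) -> (H -> H)).
Hypotheses (AA : cstar_subalgebra A) (rhoA : star_representation A rho).
Implicit Types (a b c S T : F -> F).

Let half : R[i] := (2^-1)%:C.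

Let halfE : complex.Re `|half| = 2^-1.
Proof. by rewrite Re_normc_real// invr_ge0. Qed.

(** The element [c] is [1 - sqrt (1 - h)], reached inside the possibly nonunital
    [A] as the limit of the iterates of [c |-> (h + c ^ 2) / 2] from [0].  The
    bound on [h] keeps the iterates in the ball of radius one half, on which
    this map contracts distances by one half. *)
Lemma half_square_root h : A h -> adjoint_of h h ->
  (forall x, hnorm (h x) <= 4^-1 * hnorm x) ->
  exists c, [/\ A c, adjoint_of c c & forall x, c x = half *: (h x + c (c x))].
Proof.
move=> Ah hsa hb.
pose c := fix c n : F -> F :=
  if n is m.+1 then fun x => half *: h x + half *: c m (c m x) else fun=> 0.
have scaleA a : A a -> A (fun x => half *: a x).
  move=> Aa; have := cstar_linear AA half Aa (cstar_zero AA).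
  by congr A; apply/funext => x; rewrite addr0.
have cA n : A (c n).
  elim: n => [|n IH] /=; first exact: (cstar_zero AA).
  by apply: (cstar_linear AA) => //; exact/scaleA/(cstar_mul AA).
have cb n x : hnorm (c n x) <= 2^-1 * hnorm x.
  elim: n x => [|n IH] x /=; first by rewrite hnorm0 mulr_ge0// ?invr_ge0 ?hnorm_ge0.
  apply: le_trans (hnormD _ _) _; rewrite !hnormZ halfE.
  have := IH (c n x); have := IH x; have := hb x; have := hnorm_ge0 x; lra.
have csa n : adjoint_of (c n) (c n).
  elim: n => [|n IH] x y /=; first by rewrite inner0l inner0r.
  rewrite innerDl innerDr !innerZl !innerZr hsa !IH.
  by rewrite (_ : half^* = half)// conj_Creal// complex_real.
have cbop n : bounded_op (c n) by exact: cstar_bounded AA _ (cA n).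
have cstep n x : hnorm (c n.+1 x - c n x) <= 2^-1 ^+ n * hnorm x.
  elim: n x => [|n IH] x.
    rewrite expr0 mul1r; apply: le_trans (hnormD _ _) _; rewrite hnormN.
    by have := cb 1%N x; have := cb 0%N x; have := hnorm_ge0 x; lra.
  have -> : c n.+2 x - c n.+1 x =
      half *: (c n.+1 (c n.+1 x - c n x) + (c n.+1 (c n x) - c n (c n x))).
    rewrite (bounded_opB _ _ (cbop n.+1)) addrA subrK scalerBr.
    have E1 : c n.+2 x = half *: h x + half *: c n.+1 (c n.+1 x) by [].
    have E2 : c n.+1 x = half *: h x + half *: c n (c n x) by [].
    by rewrite E1 {2}E2 opprD addrACA subrr add0r.
  rewrite hnormZ halfE exprS.
  have := hnormD (c n.+1 (c n.+1 x - c n x)) (c n.+1 (c n x) - c n (c n x)).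
  have := cb n.+1 (c n.+1 x - c n x); have := IH (c n x); have := IH x.
  have : 2^-1 ^+ n * hnorm (c n x) <= 2^-1 ^+ n * (2^-1 * hnorm x).
    by rewrite ler_wpM2l// exprn_ge0// invr_ge0.
  lra.
have /choice[l lP] x : exists l, forall n, hnorm (l - c n x) <= 2 * hnorm x * 2^-1 ^+ n.
  by apply: geometric_limit => n; rewrite mulrC.
have uniq_lim x y d : (forall n, hnorm (y - c n x) <= d * 2^-1 ^+ n) -> l x = y.
  move=> yc; apply/subr0_eq/hnorm_eq0/eqP; rewrite eq_le hnorm_ge0 andbT.
  apply: (@ler0_halves _ _ (2 * hnorm x + d)) => n.
  have := hdistD (c n x) (l x) y; rewrite (hdistC (c n x) y).
  by have := yc n; have := lP x n; lra.
have llin : linear l.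
  move=> k x y; apply: (@uniq_lim _ _ (complex.Re `|k| * (2 * hnorm x) + 2 * hnorm y)).
  move=> n; rewrite bounded_opD// bounded_opZ// opprD addrACA -scalerBr.
  apply: le_trans (hnormD _ _) _; rewrite hnormZ mulrDl lerD// -mulrA.
  by rewrite ler_wpM2l// Re_normc_ge0.
have lb x : hnorm (l x) <= 2 * hnorm x.
  by have := lP x 0%N; rewrite /= subr0 expr0 mulr1.
have lbop : bounded_op l by exact: hnorm_bounded_op lb.
exists l; split.
- apply: (cstar_closed AA) => // eps e0.
  have [n ne] : exists n, 2 * 2^-1 ^+ n <= eps.
    apply: contrapT => /forallNP hn.
    have := @ler0_halves _ eps 2; rewrite leNgt e0 /= => /(_ _)/negP[]// n.
    by have /negP := hn n; rewrite -ltNge => /ltW.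
  exists (c n) => // x; rewrite !hnormE -rmorphM lecR.
  by apply: le_trans (lP x n) _; rewrite mulrAC ler_wpM2r ?hnorm_ge0.
- move=> x y; apply/subr0_eq/Re_normc_eq0.
  apply: (@ler0_halves _ _ (2 * hnorm x * hnorm y + 2 * hnorm y * hnorm x)) => n.
  have -> : inner (l x) y - inner x (l y) =
      inner (l x - c n x) y - inner x (l y - c n y).
    by rewrite innerBl innerBr csa opprB addrA subrK.
  apply: (@le_trans _ _ (hnorm (l x - c n x) * hnorm y + hnorm x * hnorm (l y - c n y))).
    rewrite -lecR rmorphD /= -normc_Re; apply: le_trans (ler_normB _ _) _.
    rewrite (normc_Re (inner _ y)) (normc_Re (inner x _)) -!rmorphD lecR.
    by rewrite lerD// inner_le.
  have := ler_wpM2r (hnorm_ge0 y) (lP x n).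
  have := ler_wpM2l (hnorm_ge0 x) (lP y n); lra.
- move=> x; apply: (@uniq_lim _ _ (5 * hnorm x)) => n.
  have [n0|n0] := posnP n.
    rewrite n0 /= subr0 expr0 mulr1 hnormZ halfE.
    have := hnormD (h x) (l (l x)); have := lb (l x); have := lb x.
    have := hb x; have := hnorm_ge0 x; lra.
  rewrite -(prednK n0); move: n.-1 => m.
  rewrite scalerDr opprD addrACA subrr add0r -scalerBr hnormZ halfE.
  have -> : l (l x) - c m (c m x) = (l (l x) - c m (l x)) + c m (l x - c m x).
    by rewrite bounded_opB// addrA subrK.
  have := hnormD (l (l x) - c m (l x)) (c m (l x - c m x)).
  have := cb m (l x - c m x); have := lP x m; have := lP (l x) m.
  have : 2^-1 ^+ m * hnorm (l x) <= 2^-1 ^+ m * (2 * hnorm x).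
    by rewrite ler_wpM2l// exprn_ge0// invr_ge0.
  have : 0 <= 2^-1 ^+ m * hnorm x by rewrite mulr_ge0 ?exprn_ge0 ?invr_ge0 ?hnorm_ge0.
  by rewrite exprS; lra.
Qed.

Lemma rep_zero : rho (fun=> 0) = fun=> 0.
Proof.
have A0 := cstar_zero AA.
have := rep_linear rhoA (-1) A0 A0.
rewrite (_ : (fun x : F => _) = fun=> 0); last by apply/funext => x; rewrite scaler0 addr0.
by move=> ->; apply/funext => y; rewrite scaleN1r addNr.
Qed.

(** With [T^* T = 2 c - c^2] for a selfadjoint [c] in [A], one gets
    [|rho T y|^2 = |y|^2 - |y - rho c y|^2]. *)
Lemma rep_contractive T : A T ->
  (forall x, hnorm (T x) <= 2^-1 * hnorm x) ->
  forall y, hnorm (rho T y) <= hnorm y.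
Proof.
move=> AT Tb y; have [S TS] := adjoint_exists (cstar_bounded AA AT).
have AS := cstar_adjoint AA AT TS.
have Sb := adjoint_hnorm TS Tb.
pose h := S \o T; have Ah : A h by exact: cstar_mul.
have [c [Ac csa cE]] : exists c, [/\ A c, adjoint_of c c &
    forall x, c x = half *: (h x + c (c x))].
  apply: half_square_root => // [|x]; first exact: adjoint_comp (adjoint_sym TS) TS.
  by have := Sb (T x); have := Tb x; rewrite /h /=; lra.
have hE : h = fun x => -1 *: (c \o c) x + (fun x => 1 *: c x + c x) x.
  apply/funext => x /=; have := cE x; rewrite scale1r scaleN1r.
  move: (c x) (c (c x)) => d w ->; rewrite -scalerDl.
  rewrite (_ : half + half = 1) ?scale1r; last first.
    by rewrite -rmorphD /= (_ : 2^-1 + 2^-1 = 1) //; field.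
  by rewrite addrC addrK.
have rhE : inner y (rho h y) = - inner (rho c y) (rho c y) +
    (inner y (rho c y) + inner y (rho c y)).
  have Ac2 : A (fun x => 1 *: c x + c x) by exact: cstar_linear.
  rewrite hE (rep_linear rhoA)//; last exact: cstar_mul.
  rewrite (rep_mul rhoA)// (rep_linear rhoA)// scale1r scaleN1r.
  rewrite innerDr innerDr innerNr /=.
  by rewrite -[inner y (rho c _)](rep_adjoint rhoA Ac Ac csa y (rho c y)).
have : inner (rho T y) (rho T y) = inner y (rho h y).
  by rewrite (rep_adjoint rhoA AT AS TS) /h (rep_mul rhoA).
rewrite rhE !inner_hnorm => /(congr1 (@complex.Re R)) /=.
rewrite -ler_sqr ?nnegrE ?hnorm_ge0// => ->.
have := hnormB_sqr y (rho c y); have := sqr_ge0 (hnorm (y - rho c y)).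
by case: (inner y (rho c y)) => a b /=; lra.
Qed.

(** The factor [2] comes from rescaling [S] to norm at most one half; it is
    harmless, as the bound serves to pass to norm limits. *)
Lemma rep_hnorm_le S (eps : R) : 0 < eps -> A S ->
  (forall x, hnorm (S x) <= eps * hnorm x) ->
  forall y, hnorm (rho S y) <= 2 * eps * hnorm y.
Proof.
move=> e0 AS Sb y; pose k : R := (2 * eps)^-1.
have k0 : 0 < k by rewrite invr_gt0 mulr_gt0.
have AT := cstar_linear AA k%:C AS (cstar_zero AA).
have kE : complex.Re `|k%:C| = k by rewrite Re_normc_real// ltW.
have := rep_contractive AT _ y.
rewrite (rep_linear rhoA)//; last exact: cstar_zero.
rewrite rep_zero addr0 hnormZ kE ler_pdivrMl ?mulr_gt0//; apply => x.
rewrite addr0 hnormZ kE ler_pdivrMl ?mulr_gt0//.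
by apply: le_trans (Sb x) _; rewrite le_eqVlt; apply/orP; left; apply/eqP; field.
Qed.

Lemma rep_bound_approx T S (eps : R) : 0 < eps -> A T -> A S ->
  (forall x, hnorm (T x - S x) <= eps * hnorm x) ->
  forall y, hnorm (rho T y - rho S y) <= 2 * eps * hnorm y.
Proof.
move=> e0 AT AS TS y.
have := @rep_hnorm_le (fun x => -1 *: S x + T x) _ e0 _ _ y.
rewrite (rep_linear rhoA)// scaleN1r addrC; apply; first exact: cstar_linear.
by move=> x; rewrite scaleN1r addrC.
Qed.

Lemma rep_nondegenerate_star_algebra : Defs.nondegenerate A rho ->
  nondegenerate_star_algebra (rho @` A).
Proof.
move=> nd; split.
- by move=> _ [T AT <-]; exact: rep_bounded rhoA _ AT.
- by exists (fun=> 0); [exact: cstar_zero|exact: rep_zero].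
- move=> c _ _ [S AS <-] [T AT <-].
  by exists (fun x => c *: S x + T x); [exact: cstar_linear|exact: (rep_linear rhoA)].
- move=> _ _ [S AS <-] [T AT <-].
  by exists (S \o T); [exact: cstar_mul|exact: (rep_mul rhoA)].
- move=> _ [T AT <-]; have [S TS] := adjoint_exists (cstar_bounded AA AT).
  have AS := cstar_adjoint AA AT TS.
  by exists (rho S); [exists S|exact: (rep_adjoint rhoA)].
- move=> x x0; apply: hnorm_eq0; apply/eqP; rewrite -sqrf_eq0 eq_le sqr_ge0 andbT.
  apply: (le_small (hnorm_ge0 x)) => eps e0.
  have eC0 : 0 < eps%:C :> R[i] by rewrite ltcR.
  have [y [xy [n [T [u [AT yE]]]]]] := nd (ball x eps%:C)
    (ex_intro _ x (ballxx x eC0)) (ball_open x _).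
  move: xy; rewrite -ball_normE /ball_ /= hnormE ltcR => /ltW xy.
  have xy0 : inner x y = 0.
    rewrite yE; elim/big_ind: _ => [|a b xa xb|k _]; first exact: inner0r.
      by rewrite innerDr xa xb addr0.
    have [S TS] := adjoint_exists (cstar_bounded AA (AT k)).
    have AS := cstar_adjoint AA (AT k) TS.
    by rewrite -(rep_adjoint rhoA AS (AT k) (adjoint_sym TS)) x0 ?inner0l//; exists S.
  have -> : hnorm x ^+ 2 = complex.Re `|inner x (x - y)|.
    by rewrite innerBr xy0 subr0 inner_hnorm Re_normc_real// sqr_ge0.
  by apply: le_trans (inner_le _ _) _; rewrite ler_wpM2l ?hnorm_ge0.
Qed.

End Contractivity.

(** * Induction on a generated algebra *)

Section GeneratedAlgebra.
Context {R : realType} {F : hilbertType R}.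
Implicit Types (S T : F -> F) (G : set (F -> F)).

(** As [G] is selfadjoint, the operators [T] for which [Q] holds both at [T] and
    at its adjoint form a C*-subalgebra; this is why [Q] is only asked to be
    stable under sums, products and norm limits. *)
Lemma cstar_generated_ind G (Q : set (F -> F)) :
  G `<=` bounded_op ->
  (forall S T, G S -> adjoint_of S T -> G T) ->
  Q (fun=> 0) ->
  (forall (a : R[i]) S T, cstar_generated G S -> cstar_generated G T ->
    Q S -> Q T -> Q (fun x => a *: S x + T x)) ->
  (forall S T, cstar_generated G S -> cstar_generated G T ->
    Q S -> Q T -> Q (S \o T)) ->
  (forall T, cstar_generated G T ->
    (forall eps : R, 0 < eps -> exists S, [/\ cstar_generated G S, Q S &
      forall x, hnorm (T x - S x) <= eps * hnorm x]) -> Q T) ->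
  G `<=` Q -> cstar_generated G `<=` Q.
Proof.
move=> Gb Gadj Q0 Qlin Qmul Qlim GQ.
have AA := cstar_generatedP Gb.
pose B := [set T | [/\ cstar_generated G T, Q T &
  forall S, adjoint_of T S -> Q S]].
suff sub : cstar_generated G `<=` B by move=> T /sub[].
apply: smallest_sub; last first.
  move=> T GT; split; [by apply: sub_gen_smallest|exact: GQ|].
  by move=> S TS; apply/GQ/(Gadj T).
have adj T : cstar_generated G T -> exists2 S, adjoint_of T S & cstar_generated G S.
  move=> AT; have [S TS] := adjoint_exists (cstar_bounded AA AT).
  by exists S => //; exact: (cstar_adjoint AA AT TS).
split.
- by move=> T [AT _ _]; exact: (cstar_bounded AA).
- split; [exact: (cstar_zero AA)|exact: Q0|] => S OS.
  rewrite (_ : S = fun=> 0)//; apply: adjoint_unique OS _ => x y.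
  by rewrite inner0l inner0r.
- move=> a S T [AS QS QS'] [AT QT QT'].
  have [S' SS' AS'] := adj _ AS; have [T' TT' AT'] := adj _ AT.
  split; [exact: (cstar_linear AA)|exact: Qlin|] => U STU.
  rewrite (adjoint_unique STU (adjoint_lin a SS' TT')).
  by apply: Qlin => //; [exact: QS'|exact: QT'].
- move=> S T [AS QS QS'] [AT QT QT'].
  have [S' SS' AS'] := adj _ AS; have [T' TT' AT'] := adj _ AT.
  split; [exact: (cstar_mul AA)|exact: Qmul|] => U STU.
  rewrite (adjoint_unique STU (adjoint_comp SS' TT')).
  by apply: Qmul => //; [exact: QT'|exact: QS'].
- move=> S T [AS QS QS'] ST; split; [exact: (cstar_adjoint AA AS ST)|exact: QS'|].
  by move=> U TU; rewrite (adjoint_unique TU (adjoint_sym ST)).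
- move=> T Tb Tlim.
  have Tlim' (eps : R) : 0 < eps -> exists2 S, B S &
      forall x, hnorm (T x - S x) <= eps * hnorm x.
    move=> /Tlim[S BS TS]; exists S => // x.
    by have := TS x; rewrite !hnormE -rmorphM lecR.
  have AT : cstar_generated G T.
    by apply: (cstar_closed AA) => // eps /Tlim[S [AS _ _] TS]; exists S.
  split=> //; first by apply: Qlim => // eps /Tlim'[S [AS QS _] TS]; exists S.
  move=> T' TT'; apply: Qlim => [|eps /Tlim'[S [AS _ QS] TS]].
    exact: (cstar_adjoint AA AT TT').
  have [S' SS' AS'] := adj _ AS; exists S'; split=> //; first exact: QS.
  apply: (adjoint_hnorm (T := fun x => T x - S x)) => // x y.
  by rewrite innerBl innerBr TT' SS'.
Qed.

End GeneratedAlgebra.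

(** * Creators, annihilators and head projections *)

Section Words.
Implicit Types (w : wm_word) (i k : nat).

(** The vacuum gets head [0], which is below all letters: conditions of the form
    [word_head w <= i] then cover it without a separate case. *)
Definition word_head w : nat := head 0%N (val w).

Definition word_cons i w : wm_word := insubd wm_empty (i :: val w).

Lemma weakly_decreasing_head_cons i s : weakly_decreasing (i :: s) =
  [&& (0 < i)%N, (head 0%N s <= i)%N & weakly_decreasing s].
Proof.
case: s => [|j s]; first by rewrite /weakly_decreasing /= !andbT.
have [i0|/negbTE i0] := boolP (0 < i)%N; first by rewrite weakly_decreasing_cons.
by rewrite /weakly_decreasing /= i0.
Qed.

Lemma ohead_word w k :
  (ohead (val w) == Some k) = (0 < k)%N && (word_head w == k).
Proof.
rewrite /word_head; case: w => [[|i s] ws] /=; first by case: k.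
have : weakly_decreasing (i :: s) := ws; rewrite weakly_decreasing_head_cons => /andP[i0 _].
rewrite (inj_eq Some_inj); case: eqP => [<-|]; first by rewrite i0.
by rewrite andbF.
Qed.

Lemma val_word_cons i w : (0 < i)%N -> (word_head w <= i)%N ->
  val (word_cons i w) = i :: val w.
Proof.
move=> i0 wi; rewrite /word_cons insubdK//.
have : weakly_decreasing (i :: val w); last by [].
by rewrite weakly_decreasing_head_cons i0 wi; exact: valP w.
Qed.

Lemma word_head_cons i w : (0 < i)%N -> (word_head w <= i)%N ->
  word_head (word_cons i w) = i.
Proof. by move=> i0 wi; rewrite /word_head val_word_cons. Qed.

Lemma word_consK i w : (0 < i)%N -> (word_head w <= i)%N ->
  wm_tail (word_cons i w) = w.
Proof. by move=> i0 wi; apply: val_inj; rewrite val_wm_tail val_word_cons. Qed.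

Lemma word_head_tail w : (word_head (wm_tail w) <= word_head w)%N.
Proof.
rewrite /word_head val_wm_tail; case: w => [[|i s] ws] //=.
by have : weakly_decreasing (i :: s) := ws; rewrite weakly_decreasing_head_cons => /and3P[].
Qed.

Lemma word_tailK w : (0 < word_head w)%N ->
  word_cons (word_head w) (wm_tail w) = w.
Proof.
move=> w0; apply: val_inj; rewrite val_word_cons ?word_head_tail//.
by rewrite val_wm_tail; move: w0; rewrite /word_head; case: (val w).
Qed.

End Words.

Section FockRelations.
Context {R : realType}.
Local Notation fock := (weakly_monotone_fock R).
Local Notation W := (@weakly_monotone_cstar R).
Local Notation creator := (@creator R).
Implicit Types (f : fock) (w : wm_word) (i j k : nat).

(** Any adjoint of the creator will do, adjoints being unique; its coordinates
    follow from the action of the creator on basis vectors. *)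
Definition annihilator i : fock -> fock :=
  projT1 (cid (adjoint_exists (creator_bounded (R := R) i))).

Lemma creator_adjoint i : adjoint_of (creator i) (annihilator i).
Proof. by rewrite /annihilator; case: cid. Qed.

Lemma creatorE i f w : creator i f w =
  if (0 < i)%N && (word_head w == i) then f (wm_tail w) else 0.
Proof. by rewrite -ohead_word. Qed.

Lemma creator_delta i w : creator i (ell2_delta w) =
  if (0 < i)%N && (word_head w <= i)%N then ell2_delta (word_cons i w) else 0.
Proof.
apply: ell2P => v; rewrite creatorE.
have [/andP[i0 /eqP vi]|vi] := ifPn; last first.
  case: ifPn => [/andP[i0 wi]|//] /=; case: eqP => // vw.
  by move: vi; rewrite vw word_head_cons// i0 eqxx.
rewrite i0 /=; have [wi|iw] := leqP (word_head w) i => /=.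
  suff -> : (wm_tail v == w) = (v == word_cons i w) by [].
  apply/eqP/eqP => [<-|->]; last by rewrite word_consK.
  by rewrite -vi word_tailK// vi.
by case: eqP => // vw; move: iw; rewrite -vw -vi ltnNge word_head_tail.
Qed.

Lemma annihilatorE i f w : annihilator i f w =
  if (0 < i)%N && (word_head w <= i)%N then f (word_cons i w) else 0.
Proof.
rewrite -inner_delta (adjoint_sym (creator_adjoint i)) creator_delta.
by case: ifP => _; [rewrite inner_delta|rewrite inner0r].
Qed.

(** Projection onto the span of the words with letters at most [k]; the vacuum
    projection for [k = 0]. *)
Definition head_projection k : fock -> fock :=
  if k is 0 then
    fun f => -1 *: (creator 1 \o annihilator 1) f + (annihilator 1 \o creator 1) f
  else annihilator k \o creator k.

Lemma head_projectionE k f w :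
  head_projection k f w = if (word_head w <= k)%N then f w else 0.
Proof.
case: k => [|k]; last first.
  rewrite /= annihilatorE creatorE /=; case: ifP => // wk.
  by rewrite word_head_cons// eqxx word_consK.
rewrite /head_projection ell2D ell2Z /comp annihilatorE !creatorE annihilatorE mulN1r.
rewrite [(0 < 1)%N]/= !andTb.
have [w1|] := leqP (word_head w) 1; last first.
  by case: (word_head w) => [|[|m]] //= _; rewrite oppr0 addr0.
rewrite word_head_cons// eqxx word_consK//.
have [h|] := eqVneq (word_head w) 1%N.
  have ht := word_head_tail w; rewrite h in ht *.
  by rewrite ht -[X in word_cons X]h word_tailK ?h// addNr.
by move: w1; case: (word_head w) => [|[|m]] //= _ _; rewrite oppr0 add0r.
Qed.

Lemma head_projection_creator i k : (i <= k)%N ->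
  head_projection k \o creator i = creator i.
Proof.
move=> ik; apply/funext => f; apply: ell2P => w.
rewrite /comp head_projectionE; case: leqP => // kw; rewrite creatorE.
by case: eqP => [wi|]; rewrite ?andbF//; move: kw; rewrite wi ltnNge ik.
Qed.

Lemma head_projection_creator0 i k : (k < i)%N ->
  head_projection k \o creator i = fun=> 0.
Proof.
move=> ki; apply/funext => f; apply: ell2P => w.
rewrite /comp head_projectionE; case: leqP => // wk; rewrite creatorE.
by case: eqP => [wi|]; rewrite ?andbF//; move: wk; rewrite wi leqNgt ki.
Qed.

Lemma creator_head_projection i : creator i \o head_projection i = creator i.
Proof.
apply/funext => f; apply: ell2P => w; rewrite /comp !creatorE.
case: ifP => // /andP[_ /eqP wi].
by rewrite head_projectionE -wi word_head_tail.
Qed.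

Lemma head_projection_annihilator i :
  head_projection i \o annihilator i = annihilator i.
Proof.
apply/funext => f; apply: ell2P => w; rewrite /comp head_projectionE annihilatorE.
by case: (leqP (word_head w) i); rewrite ?andbF.
Qed.

Lemma annihilator_head_projection i k : (k <= i)%N ->
  annihilator k \o head_projection i = annihilator k.
Proof.
move=> ki; apply/funext => f; apply: ell2P => w; rewrite /comp !annihilatorE.
by case: ifP => // /andP[k0 wk]; rewrite head_projectionE word_head_cons// ki.
Qed.

Lemma annihilator_head_projection0 i k : (i < k)%N ->
  annihilator k \o head_projection i = fun=> 0.
Proof.
move=> ik; apply/funext => f; apply: ell2P => w; rewrite /comp annihilatorE.
case: ifP => // /andP[k0 wk].
by rewrite head_projectionE word_head_cons// leqNgt ik.
Qed.

Lemma annihilator_creator i : (0 < i)%N ->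
  annihilator i \o creator i = head_projection i.
Proof. by case: i. Qed.

Lemma annihilator_creator0 i j : i != j ->
  annihilator i \o creator j = fun=> 0.
Proof.
move=> ij; apply/funext => f; apply: ell2P => w; rewrite /comp annihilatorE.
case: ifP => // /andP[i0 wi].
by rewrite creatorE word_head_cons// (negbTE ij) andbF.
Qed.

Lemma creator_annihilator i : head_projection i.+1 =
  fun f => 1 *: (creator i.+1 \o annihilator i.+1) f + head_projection i f.
Proof.
apply/funext => f; apply: ell2P => w; rewrite ell2D ell2Z mul1r /comp.
rewrite !head_projectionE creatorE annihilatorE !andTb.
have [h|h] := eqVneq (word_head w) i.+1.
  have ht := word_head_tail w; rewrite h in ht.
  by rewrite ht h leqnn ltnn -[X in word_cons X]h word_tailK ?h// addr0.
by rewrite leq_eqVlt (negbTE h) /= add0r.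
Qed.

Lemma head_projectionM i k : (i <= k)%N ->
  head_projection i \o head_projection k = head_projection i.
Proof.
move=> ik; apply/funext => f; apply: ell2P => w; rewrite /comp !head_projectionE.
by case: (leqP (word_head w) i) => // /leq_trans ->.
Qed.

Lemma head_projectionMr i k : (i <= k)%N ->
  head_projection k \o head_projection i = head_projection i.
Proof.
move=> ik; apply/funext => f; apply: ell2P => w; rewrite /comp !head_projectionE.
by have [wi|] := leqP (word_head w) i; [rewrite (leq_trans wi ik)|case: ifP].
Qed.

Lemma head_projection_adjoint k : adjoint_of (head_projection k) (head_projection k).
Proof.
have h i : adjoint_of (annihilator i \o creator i) (annihilator i \o creator i).
  by apply: adjoint_comp; [exact/adjoint_sym/creator_adjoint|exact: creator_adjoint].
case: k => [|k] //= f g.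
rewrite innerDl innerDr innerZl innerZr -[inner (annihilator 1 _) g]/(inner ((_ \o _) f) g) h.
congr (_ + _); congr (_ * _).
  by rewrite rmorphN rmorph1.
by rewrite /= creator_adjoint -(adjoint_sym (creator_adjoint 1)).
Qed.

Lemma creator0 : creator 0 = fun=> 0.
Proof. by apply/funext => f; apply: ell2P => w; rewrite creatorE. Qed.

Lemma wm_generators_bounded : @wm_generators R `<=` bounded_op.
Proof.
move=> T [i _] [->|]; first exact: creator_bounded.
exact: adjoint_bounded (creator_bounded i).
Qed.

Lemma wm_generators_adjoint S T :
  @wm_generators R S -> adjoint_of S T -> @wm_generators R T.
Proof.
move=> [i i0 [->|iS] ST]; first by exists i => //; right.
by exists i => //; left; exact: adjoint_unique ST (adjoint_sym iS).
Qed.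

Lemma creator_in i : W (creator i).
Proof.
have [->|i0] := posnP i.
  by rewrite creator0; exact: (cstar_zero weakly_monotone_cstarP).
by apply: sub_gen_smallest; exists i => //; left.
Qed.

Lemma annihilator_in i : W (annihilator i).
Proof.
exact: (cstar_adjoint weakly_monotone_cstarP (creator_in i) (creator_adjoint i)).
Qed.

Lemma head_projection_in k : W (head_projection k).
Proof.
have WW := @weakly_monotone_cstarP R.
case: k => [|k] /=.
  apply: (cstar_linear WW); apply: (cstar_mul WW);
    by [exact: creator_in|exact: annihilator_in].
by apply: (cstar_mul WW); [exact: annihilator_in|exact: creator_in].
Qed.

End FockRelations.

(** * Commutants *)

Section Commutants.
Context {R : realType} {H : hilbertType R}.
Implicit Types (X Y S T : H -> H) (M : set (H -> H)).

Lemma bounded_op_comp S T : bounded_op S -> bounded_op T -> bounded_op (S \o T).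
Proof. exact: (cstar_mul cstar_subalgebra_bounded). Qed.

Lemma bounded_op_zero : bounded_op (fun=> 0 : H).
Proof. exact: (cstar_zero cstar_subalgebra_bounded). Qed.

Lemma commutant_zero M : M `<=` bounded_op -> commutant M (fun=> 0).
Proof.
move=> Mb; split; first exact: bounded_op_zero.
by move=> S /Mb Sb; apply/funext => x /=; rewrite bounded_op0.
Qed.

Lemma commutant_linear M (a : R[i]) S T : M `<=` bounded_op ->
  commutant M S -> commutant M T -> commutant M (fun x => a *: S x + T x).
Proof.
move=> Mb [Sb Sc] [Tb Tc]; split.
  exact: (cstar_linear cstar_subalgebra_bounded).
move=> X MX; apply/funext => x /=; have Xb := Mb _ MX.
have /(congr1 (fun f => f x)) /= -> := Sc _ MX.
have /(congr1 (fun f => f x)) /= -> := Tc _ MX.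
by rewrite bounded_opD// bounded_opZ.
Qed.

Lemma commutant_comp M S T :
  commutant M S -> commutant M T -> commutant M (S \o T).
Proof.
move=> [Sb Sc] [Tb Tc]; split; first exact: bounded_op_comp.
move=> X MX; apply/funext => x /=.
have /(congr1 (fun f => f x)) /= -> := Tc _ MX.
by have /(congr1 (fun f => f (T x))) /= := Sc _ MX.
Qed.

Lemma commutant_closed M T : M `<=` bounded_op -> bounded_op T ->
  (forall eps : R, 0 < eps -> exists2 S, commutant M S &
    forall x, hnorm (T x - S x) <= eps * hnorm x) -> commutant M T.
Proof.
move=> Mb Tb Tlim; split=> // X MX; apply/funext => x /=.
have Xb := Mb _ MX; have [c c0 Xc] := bounded_op_hnorm Xb.
apply/subr0_eq/hnorm_eq0/eqP; rewrite eq_le hnorm_ge0 andbT.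
apply: (@le_small _ _ (hnorm (X x) + c * hnorm x)) => [|eps e0].
  by rewrite addr_ge0 ?mulr_ge0 ?hnorm_ge0// ltW.
have [S [_ Sc] TS] := Tlim _ e0.
have /(congr1 (fun f => f x)) /= SX := Sc _ MX.
have -> : T (X x) - X (T x) = (T (X x) - S (X x)) - X (T x - S x).
  by rewrite bounded_opB// -SX opprB addrA subrK.
apply: le_trans (hnormD _ _) _; rewrite hnormN mulrDl lerD//.
  by rewrite mulrC.
apply: le_trans (Xc _) _; rewrite -mulrA ler_wpM2l ?(ltW c0)//.
by rewrite mulrC.
Qed.

Lemma sub_bicommutant M : M `<=` bounded_op -> M `<=` commutant (commutant M).
Proof.
move=> Mb X MX; split; first exact: Mb.
by move=> Y [_ Yc]; rewrite Yc.
Qed.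

(** [M] lies in its commutant, hence [M''] lies in [M'], which commutes with
    [M'']. *)
Lemma bicommutant_commutative M X Y : M `<=` commutant M ->
  commutant (commutant M) X -> commutant (commutant M) Y -> X \o Y = Y \o X.
Proof.
move=> Mab [Xb Xc] [Yb Yc]; apply: Xc; split=> // S MS.
by rewrite Yc//; exact: Mab.
Qed.

End Commutants.

(** * Abelian projections in a representation *)

Section Representation.
Context {R : realType} {H : hilbertType R}.
Local Notation fock := (weakly_monotone_fock R).
Local Notation W := (@weakly_monotone_cstar R).
Local Notation WW := (@weakly_monotone_cstarP R).
Variable rho : (fock -> fock) -> (H -> H).
Hypotheses (rhoW : star_representation W rho) (rhoN : Defs.nondegenerate W rho).
Implicit Types (x y : H) (X Y : H -> H) (i j k : nat) (u : seq nat).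

Let M := commutant (commutant (rho @` W)).
Let s i := rho (creator i).
Let t i := rho (annihilator i).
Let p k := rho (head_projection k).

Let rep_comp S T U : W S -> W T -> S \o T = U -> forall x, rho S (rho T x) = rho U x.
Proof. by move=> WS WT <- x; rewrite (rep_mul rhoW WS WT). Qed.

Let rep_comp0 S T : W S -> W T -> S \o T = (fun=> 0) ->
  forall x, rho S (rho T x) = 0.
Proof. by move=> WS WT ST x; rewrite (rep_comp WS WT ST) (rep_zero WW rhoW). Qed.

Let Cin := @creator_in R.
Let Ain := @annihilator_in R.
Let Pin := @head_projection_in R.

Let ps i k x : (i <= k)%N -> p k (s i x) = s i x.
Proof. by move=> ik; apply: rep_comp => //; exact: head_projection_creator. Qed.

Let ps0 i k x : (k < i)%N -> p k (s i x) = 0.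
Proof. by move=> ik; apply: rep_comp0 => //; exact: head_projection_creator0. Qed.

Let sp i x : s i (p i x) = s i x.
Proof. by apply: rep_comp => //; exact: creator_head_projection. Qed.

Let pt i x : p i (t i x) = t i x.
Proof. by apply: rep_comp => //; exact: head_projection_annihilator. Qed.

Let tp i k x : (k <= i)%N -> t k (p i x) = t k x.
Proof. by move=> ki; apply: rep_comp => //; exact: annihilator_head_projection. Qed.

Let tp0 i k x : (i < k)%N -> t k (p i x) = 0.
Proof. by move=> ki; apply: rep_comp0 => //; exact: annihilator_head_projection0. Qed.

Let ts i x : (0 < i)%N -> t i (s i x) = p i x.
Proof. by move=> i0; apply: rep_comp => //; exact: annihilator_creator. Qed.

Let ts0 i j x : i != j -> t i (s j x) = 0.
Proof. by move=> ij; apply: rep_comp0 => //; exact: annihilator_creator0. Qed.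

Let pE i x : (0 < i)%N -> p i x = s i (t i x) + p i.-1 x.
Proof.
case: i => // i _.
rewrite /p creator_annihilator (rep_linear rhoW)//; last exact: (cstar_mul WW).
by rewrite scale1r (rep_mul rhoW).
Qed.

Let pp i k x : (i <= k)%N -> p i (p k x) = p i x.
Proof. by move=> ik; apply: rep_comp => //; exact: head_projectionM. Qed.

Let ppr i k x : (i <= k)%N -> p k (p i x) = p i x.
Proof. by move=> ik; apply: rep_comp => //; exact: head_projectionMr. Qed.

Let s0 x : s 0 x = 0.
Proof. by rewrite /s creator0 (rep_zero WW rhoW). Qed.

Let t0 x : t 0 x = 0.
Proof.
apply: inner_eq => y; rewrite inner0r -(rep_adjoint rhoW (Cin 0) (Ain 0)) //.
  by rewrite -/(s 0) s0 inner0l.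
exact: creator_adjoint.
Qed.

Let sb i : bounded_op (s i).
Proof. exact: (rep_bounded rhoW). Qed.

Let tb i : bounded_op (t i).
Proof. exact: (rep_bounded rhoW). Qed.

Let pb i : bounded_op (p i).
Proof. exact: (rep_bounded rhoW). Qed.

Let psa i : adjoint_of (p i) (p i).
Proof. by apply: (rep_adjoint rhoW) => //; exact: head_projection_adjoint. Qed.

Let BB := rep_nondegenerate_star_algebra WW rhoW rhoN.

Let BM : rho @` W `<=` M.
Proof. by apply: sub_bicommutant; exact: nsa_bounded BB. Qed.

(** The generators satisfy [s_i = p_i s_i] and [t_i = p_i t_i], so a projection
    killing all the [p k] kills the whole image of [rho] from the left, and is
    then zero by nondegeneracy. *)
Lemma exists_head_projection z : projection z -> z <> (fun=> 0) ->
  exists k, z \o p k <> fun=> 0.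
Proof.
move=> [zb _ zsa] z0; apply: contrapT => /forallNP h; apply: z0.
have zp k x : z (p k x) = 0.
  by have /contrapT/(congr1 (fun f => f x)) := h k.
have zrho : W `<=` [set T | forall x, z (rho T x) = 0].
  apply: (cstar_generated_ind (G := @wm_generators R)).
  - exact: wm_generators_bounded.
  - exact: wm_generators_adjoint.
  - by move=> x; rewrite (rep_zero WW rhoW) bounded_op0.
  - move=> a S T WS WT zS zT x; rewrite (rep_linear rhoW)//.
    by rewrite bounded_opD// bounded_opZ// zS zT scaler0 addr0.
  - by move=> S T WS WT zS _ x; rewrite (rep_mul rhoW)//= zS.
  - move=> T WT Tlim x; have [c c0 zc] := bounded_op_hnorm zb.
    apply/hnorm_eq0/eqP; rewrite eq_le hnorm_ge0 andbT.
    apply: (@le_small _ _ (c * 2 * hnorm x)) => [|eps e0].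
      by rewrite !mulr_ge0 ?hnorm_ge0// ltW.
    have [S [WS zS TS]] := Tlim _ e0.
    rewrite -[z _]subr0 -(zS x) -bounded_opB//; apply: le_trans (zc _) _.
    rewrite (_ : _ * eps = c * (2 * eps * hnorm x)); last by ring.
    by rewrite ler_wpM2l ?(ltW c0)//; exact: (rep_bound_approx WW rhoW).
  - move=> T [i _ [->|iT]] x; first by rewrite -/(s i) -(@ps i i)// zp.
    rewrite (adjoint_unique iT (@creator_adjoint R i)).
    by rewrite -/(t i) -pt zp.
apply/funext => x; apply: (nsa_nondegenerate BB) => _ [T WT <-].
have [T' TT'] := adjoint_exists (cstar_bounded WW WT).
have WT' := cstar_adjoint WW WT TT'.
apply: inner_eq => y; rewrite inner0r inner_conj (rep_adjoint rhoW WT WT' TT').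
by rewrite zsa zrho// inner0r conjC0.
Qed.

Section LowestLevel.
Variables (z : H -> H) (n : nat).
Hypotheses (zcentral : central_projection M z).
Hypothesis (zlow : forall k, (k < n)%N -> forall x, z (p k x) = 0).

Let zproj : projection z. Proof. by case: zcentral. Qed.
Let zb : bounded_op z. Proof. by case: zproj. Qed.

Let zC T x : W T -> z (rho T x) = rho T (z x).
Proof.
move=> WT; have [_ _ [_ zc]] := zcentral.
have MT : M (rho T) by apply: BM; exists T.
by have /(congr1 (fun f => f x)) := zc _ MT.
Qed.

Let zs i x : z (s i x) = s i (z x). Proof. exact: zC. Qed.

Let zt i x : z (t i x) = t i (z x). Proof. exact: zC. Qed.

Let zp i x : z (p i x) = p i (z x). Proof. exact: zC. Qed.

Let zz x : z (z x) = z x.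
Proof. by have [_ /(congr1 (fun f => f x))] := zproj. Qed.

Let e := z \o p n.

Let eb : bounded_op e. Proof. exact: bounded_op_comp. Qed.

Let ee x : e (e x) = e x.
Proof. by rewrite /e /= -[p n (z _)]zp zz pp. Qed.

Lemma lowest_projection : projection e.
Proof.
split=> //; first by apply/funext => x /=; rewrite ee.
move=> x y; have [_ _ zsa] := zproj.
by rewrite /e /= zsa psa zp.
Qed.

Let ep k x : (n <= k)%N -> e (p k x) = e x.
Proof. by move=> nk; rewrite /e /= pp. Qed.

Let ep0 k x : (k < n)%N -> e (p k x) = 0.
Proof. by move=> kn; rewrite /e /= ppr ?(ltnW kn)// zlow. Qed.

(* Levels above [n] are orthogonal to [p_n]; levels below it are killed by [z],
   since [s_i = p_i s_i]. *)
Let es0 i x : i != n -> e (s i x) = 0.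
Proof.
rewrite neq_ltn => /orP[ni|ni]; rewrite /e /=.
  by rewrite ps ?(ltnW ni)// -(@ps i i)// zlow.
by rewrite ps0// bounded_op0.
Qed.

Let es x : e (s n x) = s n (e x).
Proof. by rewrite /e /= ps// -zs sp. Qed.

Let te0 i x : i != n -> t i (e x) = 0.
Proof.
rewrite neq_ltn => /orP[ni|ni]; rewrite /e /= -zt.
  by rewrite tp ?(ltnW ni)// -pt zlow.
by rewrite tp0// bounded_op0.
Qed.

Let te x : e (t n x) = t n (e x).
Proof. by rewrite /e /= pt -zt tp. Qed.

Let N := s n \o e.
Let N' := t n \o e.
Let G := [set X | [\/ X = e, X = N | X = N']].
Let C := commutant (commutant G).

Let Gb : G `<=` bounded_op.
Proof. by move=> X [->|->|->] //; exact: bounded_op_comp. Qed.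

Let CGb : commutant G `<=` bounded_op. Proof. by move=> X []. Qed.

(* The relations [s_n^* s_n = p_n] and [s_n s_n^* = p_n - p_(n-1)] make the
   isometry [s_n] unitary on [e H], because [z] kills [p_(n-1)].  For [n = 0]
   both operators vanish. *)
Let NN x : N (N' x) = N' (N x).
Proof.
rewrite /N /N' /= te es !ee.
have [n0|n0] := posnP n; first by rewrite n0 s0 t0.
rewrite ts// pE// [p n.-1 _](_ : _ = 0) ?addr0//.
by rewrite /e /= -zp pp ?leq_pred// zlow// prednK.
Qed.

Let eN x : e (N x) = N x. Proof. by rewrite /N /= es ee. Qed.
Let eN' x : e (N' x) = N' x. Proof. by rewrite /N' /= te ee. Qed.
Let Ne x : N (e x) = N x. Proof. by rewrite /N /= ee. Qed.
Let N'e x : N' (e x) = N' x. Proof. by rewrite /N' /= ee. Qed.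

Let Gab : G `<=` commutant G.
Proof.
move=> X GX; split; first exact: Gb.
move=> Y GY; apply/funext => x /=.
by case: GX => ->; case: GY => ->; rewrite ?eN ?eN' ?Ne ?N'e ?NN.
Qed.

Let C0 : C (fun=> 0). Proof. exact: commutant_zero. Qed.

Let Cext X Y : (forall x, X x = Y x) -> C Y -> C X.
Proof. by move=> XY; rewrite (_ : X = Y)//; apply/funext. Qed.

Let GC : G `<=` C. Proof. exact: sub_bicommutant. Qed.

Let Ce : C e. Proof. by apply: GC; apply: Or31. Qed.
Let CN : C N. Proof. by apply: GC; apply: Or32. Qed.
Let CN' : C N'. Proof. by apply: GC; apply: Or33. Qed.

(* [s_u^*] for the word [u], that is, [t_j] for its letters from left to
   right. *)
Let tw := fix tw u : H -> H := if u is j :: v then tw v \o t j else id.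

Let twb u : bounded_op (tw u).
Proof.
elim: u => [|j u IH] /=; last exact: bounded_op_comp.
by apply: (@hnorm_bounded_op _ _ _ 1) => // x; rewrite mul1r.
Qed.

Let ew0 u : e (tw u 0) = 0.
Proof. by rewrite !bounded_op0. Qed.

(* A left module over the image of [rho]: letting [u] range over all words makes
   it stable under [s_i^*], and under [s_i] because [s_j^* s_i] is [0] or
   [p_i].  It contains [e], and the empty word yields the compressions
   [e rho(T) e]. *)
Let good := [set X | bounded_op X /\ forall u, C (e \o tw u \o X)].

Let good_s i X : good X -> good (s i \o X).
Proof.
move=> [Xb XC]; split=> [|[|j u]]; first exact: bounded_op_comp.
- have [->|ni] := eqVneq i n; last by apply: Cext C0 => x /=; rewrite es0.
  apply: (@Cext _ (N \o (e \o tw [::] \o X))) => [x|].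
    by rewrite /N /= ee es.
  exact: commutant_comp CN (XC [::]).
- have [->|ij] := eqVneq j i; last first.
    by apply: Cext C0 => x /=; rewrite ts0// ew0.
  have [->|i0] := posnP i.
    by apply: Cext C0 => x /=; rewrite s0 t0 ew0.
  case: u => [|k u].
    have [ni|ni] := leqP n i.
      by apply: Cext (XC [::]) => x /=; rewrite ts// ep.
    by apply: Cext C0 => x /=; rewrite ts// ep0.
  have [ki|ki] := leqP k i.
    by apply: Cext (XC (k :: u)) => x /=; rewrite ts// tp.
  by apply: Cext C0 => x /=; rewrite ts// tp0// ew0.
Qed.

Let good_t i X : good X -> good (t i \o X).
Proof.
move=> [Xb XC]; split=> [|u]; first exact: bounded_op_comp.
exact: (XC (i :: u)).
Qed.

Let good_rho T : W T -> forall X, good X -> good (rho T \o X).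
Proof.
move: T; apply: (cstar_generated_ind (G := @wm_generators R)).
- exact: wm_generators_bounded.
- exact: wm_generators_adjoint.
- move=> X _; rewrite (rep_zero WW rhoW); split; first exact: bounded_op_zero.
  by move=> u; apply: Cext C0 => x /=; rewrite ew0.
- move=> a S T WS WT gS gT X gX; rewrite (rep_linear rhoW)//.
  have [Sb SC] := gS X gX; have [Tb TC] := gT X gX; split=> [|u].
    exact: (cstar_linear cstar_subalgebra_bounded).
  have ub := bounded_op_comp eb (twb u).
  apply: Cext (commutant_linear a CGb (SC u) (TC u)) => x.
  by rewrite -[LHS]/((e \o tw u) (_ + _)) bounded_opD// bounded_opZ.
- move=> S T WS WT gS gT X gX; rewrite (rep_mul rhoW)//.
  exact/(gS (rho T \o X))/gT.
- move=> T WT Tlim X gX; have [Xb _] := gX.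
  have Tb : bounded_op (rho T) by exact: (rep_bounded rhoW).
  split=> [|u]; first exact: bounded_op_comp.
  have ub := bounded_op_comp eb (twb u).
  apply: commutant_closed => // [|eps eps0]; first by do 2 apply: bounded_op_comp => //.
  have [c c0 uc] := bounded_op_hnorm ub; have [d d0 Xd] := bounded_op_hnorm Xb.
  have del0 : 0 < eps / (c * (2 * d)) by rewrite divr_gt0// !mulr_gt0.
  have [S [WS gS TS]] := Tlim _ del0.
  exists (e \o tw u \o (rho S \o X)); first by have [_] := gS _ gX; apply.
  move=> x; rewrite -[leLHS]/(hnorm ((e \o tw u) (rho T (X x)) - (e \o tw u) (rho S (X x)))).
  rewrite -bounded_opB//; apply: le_trans (uc _) _.
  rewrite (_ : eps * _ = c * (2 * (eps / (c * (2 * d))) * (d * hnorm x))); last first.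
    by field; rewrite !gt_eqF.
  rewrite ler_wpM2l ?(ltW c0)//.
  apply: le_trans (rep_bound_approx WW rhoW del0 WT WS TS _) _.
  by rewrite ler_wpM2l// mulr_ge0// ltW.
- move=> T [i _ [->|iT]]; first exact: good_s.
  by rewrite (adjoint_unique iT (@creator_adjoint R i)); exact: good_t.
Qed.

Let good_e : good e.
Proof.
split=> // u; suff h Y : C Y -> C (e \o tw u \o (e \o Y)).
  apply: (@Cext _ (e \o tw u \o (e \o e))) => [x|]; first by rewrite /= ee.
  exact: h.
elim: u Y => [|j u IH] Y CY.
  apply: (@Cext _ (e \o Y)) => [x|]; first by rewrite /= ee.
  exact: commutant_comp Ce CY.
have [->|jn] := eqVneq j n; last first.
  by apply: Cext C0 => x /=; rewrite te0// ew0.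
apply: (@Cext _ (e \o tw u \o (e \o (N' \o Y)))) => [x|].
  by rewrite /= eN'.
exact/IH/(commutant_comp CN' CY).
Qed.

Let compression_in_C T : W T -> C (e \o (rho T \o e)).
Proof. by move=> /good_rho/(_ _ good_e)[_ /(_ [::])]. Qed.

(** The compressions of the image of [rho] lie in the commutative algebra [C], and
    commutativity passes from them to those of [M]. *)
Lemma lowest_abelian : abelian_projection M e.
Proof.
have aB a b : (rho @` W) a -> (rho @` W) b ->
    forall x, e (a (e (b (e x)))) = e (b (e (a (e x)))).
  move=> [S WS <-] [T WT <-] x.
  have := bicommutant_commutative Gab (compression_in_C WS) (compression_in_C WT).
  by move=> /(congr1 (fun f => f x)); rewrite /= !ee.
split; first exact: lowest_projection.
  by have [_ Mz _] := zcentral; apply: commutant_comp Mz _; apply: BM; exists (head_projection n).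
move=> S T MS MT; apply/funext => x /=; rewrite !ee.
exact: (bicommutant_compression BB lowest_projection aB MS MT).
Qed.

End LowestLevel.

(** The level [n] is chosen minimal, so that [z] kills all the lower ones. *)
Lemma bicommutant_typeI : typeI_von_neumann M.
Proof.
move=> z zcentral z0; have [zproj _ _] := zcentral.
have [k zk] := exists_head_projection zproj z0.
have ex : exists k, `[< z \o p k <> (fun=> 0) >] by exists k; apply/asboolP.
case: (ex_minnP ex) => n /asboolP zn nmin.
have zlow j : (j < n)%N -> forall x, z (p j x) = 0.
  move=> jn x; have /(congr1 (fun f => f x)) : z \o p j = fun=> 0; last by [].
  apply: contrapT => /asboolP/nmin; by rewrite leqNgt jn.
exists (z \o p n); split=> //; first exact: lowest_abelian.
by have [_ zz _] := zproj; rewrite compA zz.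
Qed.

End Representation.

Theorem corollary3p14 (R : realType) : typeI_cstar (@weakly_monotone_cstar R).
Proof. by move=> H rho rhoW rhoN; exact: bicommutant_typeI. Qed.
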